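(* Let $c>0$, $T>0$, $-\frac13<\lambda<0$ and $0<\beta<1-\frac{4\lambda+2}{\sqrt{(2\lambda+3)(8\lambda+3)}}$. Let $\psi(x,t)=-\log(1+ct)-\log(1+x+ct)$ and $\varphi=e^{\lambda\psi}$. There exist constants $C>0$ and $S_0\ge 1$, depending on $c,T,\lambda,\beta$ but not on $R_0$, such that for every $R_0>0$, every smooth $v$ on $\overline{Q_{R_0}}$ with $v=0$ in a neighborhood of $t=0$ and of $t=T$, and every $s\le -S_0$, $$\begin{aligned} &\int_{Q_{R_0}}e^{2s\varphi}\left((-s)^3\varphi^3|v|^2+(-s)(|v_t|^2+|v_x|^2)\right)dx\,dt \le C\int_{Q_{R_0}}e^{2s\varphi}|\square v|^2\,dx\,dt\\ &\quad +C\int_0^T e^{2s\varphi(0,t)}\left((-s)^3\varphi(0,t)^3|v(0,t)|^2+(-s)\varphi(0,t)\bigl(|v_t(0,t)|^2+|v_x(0,t)|^2\bigr)\right)dt\\ &\quad +C\int_0^T e^{2s\varphi(R_0,t)}\left((-s)^3\varphi(R_0,t)^3|v(R_0,t)|^2+(-s)\varphi(R_0,t)\bigl(|v_t(R_0,t)|^2+|v_x(R_0,t)|^2\bigr)\right)dt. \end{aligned}$$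
   Context: All functions are real-valued. For $R_0>0$, $Q_{R_0}=(0,R_0)\times(0,T)$ with variables $(x,t)$. The wave operator is $\square v=v_{tt}-c^2v_{xx}$ with constant wave speed $c>0$. Explicitly $\varphi(x,t)=(1+ct)^{-\lambda}(1+x+ct)^{-\lambda}\ge 1$. The parameter $s$ is negative. *)

(* Defs.v *)
From HB Require Import structures.
From mathcomp Require Import all_boot all_order all_algebra.
From mathcomp Require Import all_classical all_reals all_analysis.

Set Implicit Arguments.
Unset Strict Implicit.
Unset Printing Implicit Defensive.
Import Order.TTheory GRing.Theory Num.Theory.
Import numFieldNormedType.Exports.
Local Open Scope classical_set_scope.
Local Open Scope ring_scope.

(* Functions of (x, t) are functions on R * R, with z.1 = x and z.2 = t. *)

(* Derivative of f at a relative to A: one-sided if a is an endpoint of the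
   interval A, the ordinary derivative if a is an interior point of A. *)
Definition diff_quot (R : realType) (f : R -> R) (a y : R) : R :=
  (f y - f a) / (y - a).

Definition derivable_within (R : realType) (A : set R) (f : R -> R) (a : R) :
    Prop :=
  cvg (diff_quot f a y @[y --> within A a^']).

Definition derive_within (R : realType) (A : set R) (f : R -> R) (a : R) : R :=
  lim (diff_quot f a y @[y --> within A a^']).

Definition Q (R : realType) (R0 T : R) : set (R * R) := `]0, R0[ `*` `]0, T[.

Definition Qbar (R : realType) (R0 T : R) : set (R * R) :=
  `[0, R0] `*` `[0, T].

Definition dx (R : realType) (R0 : R) (v : R * R -> R) (z : R * R) : R :=
  derive_within `[0, R0] (fun x => v (x, z.2)) z.1.

Definition dt (R : realType) (T : R) (v : R * R -> R) (z : R * R) : R :=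
  derive_within `[0, T] (fun t => v (z.1, t)) z.2.

(* C^k up to the boundary of the closed rectangle; v is unconstrained outside
   Qbar R0 T and no extension of v beyond it is assumed. *)
Fixpoint is_Ck (R : realType) (R0 T : R) (k : nat) (v : R * R -> R) : Prop :=
  {within Qbar R0 T, continuous v} /\
  if k is k'.+1 then
    [/\ (forall z, Qbar R0 T z ->
           derivable_within `[0, R0] (fun x => v (x, z.2)) z.1 /\
           derivable_within `[0, T] (fun t => v (z.1, t)) z.2),
        is_Ck R0 T k' (dx R0 v) &
        is_Ck R0 T k' (dt T v)]
  else True.

Definition smooth_on_Qbar (R : realType) (R0 T : R) (v : R * R -> R) : Prop :=
  forall k, is_Ck R0 T k v.

Definition box (R : realType) (c R0 T : R) (v : R * R -> R) (z : R * R) : R :=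
  dt T (dt T v) z - c ^+ 2 * dx R0 (dx R0 v) z.

Definition vanishes_near_ends (R : realType) (R0 T : R) (v : R * R -> R) :
    Prop :=
  exists2 d : R, 0 < d &
    forall x t, Qbar R0 T (x, t) -> t < d \/ T - d < t -> v (x, t) = 0.

Definition psi (R : realType) (c : R) (z : R * R) : R :=
  - ln (1 + c * z.2) - ln (1 + z.1 + c * z.2).

Definition phi (R : realType) (c lambda : R) (z : R * R) : R :=
  expR (lambda * psi c z).

Definition interior_density (R : realType) (c lambda R0 T s : R)
    (v : R * R -> R) (z : R * R) : R :=
  expR (2 * s * phi c lambda z) *
  ((- s) ^+ 3 * phi c lambda z ^+ 3 * `|v z| ^+ 2 +
   (- s) * (`|dt T v z| ^+ 2 + `|dx R0 v z| ^+ 2)).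

Definition source_density (R : realType) (c lambda R0 T s : R)
    (v : R * R -> R) (z : R * R) : R :=
  expR (2 * s * phi c lambda z) * `|box c R0 T v z| ^+ 2.

(* Unlike interior_density, phi also multiplies the gradient term here. *)
Definition boundary_density (R : realType) (c lambda R0 T s : R)
    (v : R * R -> R) (z : R * R) : R :=
  expR (2 * s * phi c lambda z) *
  ((- s) ^+ 3 * phi c lambda z ^+ 3 * `|v z| ^+ 2 +
   (- s) * phi c lambda z * (`|dt T v z| ^+ 2 + `|dx R0 v z| ^+ 2)).

(* Main.v *)
Require Import Defs.
From HB Require Import structures.
From mathcomp Require Import all_boot all_order all_algebra.
From mathcomp Require Import all_classical all_reals all_analysis.
From mathcomp Require Import measurable_realfun.
From mathcomp Require Import ring lra.
Set Implicit Arguments.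
Unset Strict Implicit.
Unset Printing Implicit Defensive.

Import Order.TTheory GRing.Theory Num.Theory.
Import numFieldNormedType.Exports.
Local Open Scope classical_set_scope.
Local Open Scope ring_scope.

(** Put mu = - lambda, which lies in (0, 1/3), and sigma = - s > 0, and measure
    time by tau = c t, so that the wave operator is c^2 times
    d_tau^2 - d_x^2. With A = 1 / (1 + c t) and B = 1 / (1 + x + c t) the weight
    satisfies phi_tau = mu phi (A + B) and phi_x = mu phi B, and
    0 < B <= A <= 1 on the rectangle.

    The estimate is an energy identity for the conjugated function
    W = exp (- sigma phi) v. Conjugating the wave operator by the weight gives
    P1 + P2 - M, where P1 = W_tautau - W_xx + sigma^2 (phi_tau^2 - phi_x^2) W is
    formally symmetric, P2 = 2 sigma (phi_tau W_tau - phi_x W_x) is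
    antisymmetric up to order zero, and M = sigma (phi_xx - phi_tautau) W is of
    order zero ([conjugated_wave]). The product P1 P2 is a
    divergence plus a quadratic form in (W, W_x, W_tau)
    ([multiplier_identity]), and this form is positive definite: since
    phi_tau > phi_x > 0 the weight is timelike, the gradient part is diagonal in
    W_tau + W_x and W_tau - W_x, and both its eigenvalues and the coefficient of
    W^2 are bounded below by powers of A as long as mu < 1/3 ([bulk_ge]).
    As P1 P2 is at most the square of the source plus the square of M, and the
    latter has one power of sigma phi less than the W^2 term, it is absorbed
    when sigma mu >= 1 ([pointwise_carleman]). The only lower bound on A that is
    used is 1 / (1 + c T), and phi enters only through phi >= 1; this is why the
    constants do not depend on R0, although phi is unbounded in x.

    It remains to integrate. The tau-component of the flux vanishes for t near 0
    and T, where v does; the x-component leaves its values at x = 0 and x = R0,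
    which the boundary densities control ([fluxX_le]). The divergence theorem on
    the rectangle is the fundamental theorem of calculus on slices together with
    Fubini's theorem ([integral_dx], [integral_dt]). It needs every integrand to
    be continuous up to the boundary, hence measurable for the product
    sigma-algebra, and the two mixed derivatives of v to agree in the interior
    ([mixed_partials_eq]), because W_xtau occurs in both components. *)

(** * Continuous functions on the closed rectangle are integrable *)

(** The plane is second countable: an open set is a union of balls with rational
    centres and radii 1 / (n + 1), and each ball is a product of intervals. *)
Lemma open_measurable_prod (R : realType) (U : set (R * R)) :
  open U -> measurable (U : set (measurableTypeR R * measurableTypeR R)).
Proof.
move=> oU.
(* Indices whose ball is not inside U contribute the empty set, so that the
   union may range over a whole countable type. *)
pose F (p : rat * rat * nat) : set (R * R) :=
  let b := ball ((ratr p.1.1, ratr p.1.2) : R * R) p.2.+1%:R^-1 in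
  if `[< b `<=` U >] then b else set0.
have -> : U = \bigcup_p F p.
  apply/seteqP; split => [[x t] Uz|z [p _]]; last first.
    by rewrite /F; case: asboolP => [bU /bU|_ []].
  have /nbhs_ballP[e /= e0 eU] : nbhs (x, t) U by exact: open_nbhs_nbhs.
  have e20 : 0 < e / 2 by rewrite divr_gt0.
  have [n _ /(_ n (leqnn n)) /= ne] := near_infty_natSinv_lt (PosNum e20).
  have n0 : 0 < n.+1%:R^-1 :> R by rewrite invr_gt0 ltr0n.
  have rat_near (y : R) : exists q : rat, `|ratr q - y| < n.+1%:R^-1.
    have /rat_in_itvoo[q] : y < y + n.+1%:R^-1 by rewrite ltrDl.
    rewrite in_itv/= => /andP[yq qy]; exists q.
    by rewrite gtr0_norm ?subr_gt0// ltrBlDl.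
  have [[q1 h1] [q2 h2]] := (rat_near x, rat_near t).
  have bU : ball ((ratr q1, ratr q2) : R * R) n.+1%:R^-1 `<=` U.
    move=> [y r] [/= by1 by2]; apply: eU; rewrite (splitr e); split => /=.
      apply: (ball_triangle (y := ratr q1 : R));
        apply: (le_ball (ltW ne)) => //.
      by rewrite -ball_normE /ball_/= distrC.
    apply: (ball_triangle (y := ratr q2 : R)); apply: (le_ball (ltW ne)) => //.
    by rewrite -ball_normE /ball_/= distrC.
  exists (q1, q2, n) => //; rewrite /F /= (asboolT bU).
  by split; rewrite /= -ball_normE.
apply: countable_bigcupT_measurable => // p.
rewrite /F; case: asboolP => // _.
by apply: measurableX; apply: open_measurable; exact: ball_open.
Qed.


Lemma within_measurable_prod (R : realType) (D : set (R * R)) (f : R * R -> R) :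
  measurable (D : set (measurableTypeR R * measurableTypeR R)) ->
  {within D, continuous f} ->
  measurable_fun (D : set (measurableTypeR R * measurableTypeR R)) f.
Proof.
move=> mD /continuousP cf; apply: (measurability _ (RGenOpens.measurableE R)).
move=> _ [_ [a [b ->] <-]].
have oab := @interval_open R (BRight a) (BLeft b) isT isT.
have /open_subspaceP[V oV VD] := cf _ oab.
rewrite setIC -VD.
by apply: measurableI => //; exact: open_measurable_prod.
Qed.

Lemma measurable_Q (R : realType) (R0 T : R) :
  measurable (Q R0 T : set (measurableTypeR R * measurableTypeR R)).
Proof. by apply: measurableX; exact: measurable_itv. Qed.

Lemma subset_Q_Qbar (R : realType) (R0 T : R) : Q R0 T `<=` Qbar R0 T.
Proof. by move=> z [/= zx zt]; split; apply: subset_itv_oo_cc. Qed.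

Lemma Qbar_bounded (R : realType) (R0 T : R) (f : R * R -> R) :
  {within Qbar R0 T, continuous f} ->
  exists M : R, forall z, Qbar R0 T z -> `|f z| <= M.
Proof.
move=> cf.
have cQ : compact (Qbar R0 T) by apply: compact_setX; exact: segment_compact.
have /compact_bounded[M [_ fM]] := continuous_compact cf cQ.
exists (M + 1) => z Qz; apply: (fM (M + 1)); first by rewrite ltrDl.
by exists z.
Qed.

Lemma integrable_Q (R : realType) (R0 T : R) (f : R * R -> R) :
  {within Qbar R0 T, continuous f} ->
  (@lebesgue_measure R \x @lebesgue_measure R)%E.-integrable (Q R0 T)
    (EFin \o f).
Proof.
move=> cf; apply: measurable_bounded_integrable.
- exact: measurable_Q.
- apply: (@le_lt_trans _ _ ((@lebesgue_measure R \x @lebesgue_measure R)%E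
      (`]0%R, R0[ `*` `]0%R, T[))) => //.
  rewrite product_measure1E; [|exact: measurable_itv|exact: measurable_itv].
  rewrite /= !lebesgue_measure_itv /=.
  by do 2 case: ifP => _; rewrite ?mule0 ?mul0e ?ltry -?EFinB -?EFinM ?ltry.
- apply: within_measurable_prod; first exact: measurable_Q.
  by apply: continuous_subspaceW cf; exact: subset_Q_Qbar.
- have [M fM] := Qbar_bounded cf.
  exists M; split; first exact: num_real.
  by move=> N MN z Qz; apply/(le_trans _ (ltW MN))/fM; exact: subset_Q_Qbar.
Qed.

Lemma continuous_slice1 (R : realType) (R0 T t : R) (f : R * R -> R) :
  {within Qbar R0 T, continuous f} -> t \in `[0, T] ->
  {within `[0, R0], continuous (fun x => f (x, t))}.
Proof.
move=> /subspace_continuousP cf tT; apply/subspace_continuousP => x /= xR.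
apply: (@cvg_comp _ _ _ (fun x => (x, t)) f _
  (within (Qbar R0 T) (nbhs (x, t)))); last by apply: cf.
move=> A; rewrite /= /within /= => -[[U V] /= [Ux Vt] UV].
apply: filterS Ux => y Uy yR; apply: UV => //; split => //=.
exact: nbhs_singleton.
Qed.

Lemma continuous_slice2 (R : realType) (R0 T x : R) (f : R * R -> R) :
  {within Qbar R0 T, continuous f} -> x \in `[0, R0] ->
  {within `[0, T], continuous (fun t => f (x, t))}.
Proof.
move=> /subspace_continuousP cf xR; apply/subspace_continuousP => t /= tT.
apply: (@cvg_comp _ _ _ (fun t => (x, t)) f _
  (within (Qbar R0 T) (nbhs (x, t)))); last by apply: cf.
move=> A; rewrite /= /within /= => -[[U V] /= [Ux Vt] UV].
apply: filterS Vt => y Uy yR; apply: UV => //; split => //=.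
exact: nbhs_singleton.
Qed.

(** * The divergence theorem on the rectangle *)

(** Differentiability is required in the interior only: at the end points
    continuity up to the boundary replaces it. *)
Lemma FTC_open_itv (R : realType) (a b : R) (F f : R -> R) : a < b ->
  {within `[a, b], continuous F} -> {within `[a, b], continuous f} ->
  (forall x, x \in `]a, b[ -> is_derive x 1 F (f x)) ->
  (\int[@lebesgue_measure R]_(x in `]a, b[) (f x)%:E = (F b - F a)%:E)%E.
Proof.
move=> ab cF cf dF.
have mf : measurable_fun `]a, b[ (EFin \o f).
  apply/measurable_EFinP; apply: subspace_continuous_measurable_fun => //.
  by apply: continuous_subspaceW cf; exact: subset_itv_oo_cc.
have dFab : derivable_oo_LRcontinuous F a b.
  have [_ cFa cFb] := (continuous_within_itvP _ ab).1 cF.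
  by split => // x /dF [].
have dFE : {in `]a, b[, derive1 F =1 f}.
  by move=> x /dF [_ <-]; rewrite derive1E.
transitivity (\int[@lebesgue_measure R]_(x in `[a, b]) (f x)%:E)%E.
  exact/esym/integral_itv_bndoo.
by rewrite EFinB; exact: continuous_FTC2 ab cf dFab dFE.
Qed.

(** A flux along x contributes its values on the two vertical sides; by Fubini
    this is [FTC_open_itv] on each horizontal slice. *)
Lemma integral_dx (R : realType) (R0 T : R) (H h : R * R -> R) : 0 < R0 ->
  {within Qbar R0 T, continuous H} -> {within Qbar R0 T, continuous h} ->
  (forall x t, x \in `]0, R0[ -> t \in `]0, T[ ->
     is_derive x 1 (fun y => H (y, t)) (h (x, t))) ->
  (\int[(@lebesgue_measure R \x @lebesgue_measure R)]_(z in Q R0 T) (h z)%:E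
   = \int[@lebesgue_measure R]_(t in `]0%R, T[)
       (H (R0, t) - H (0, t))%:E)%E.
Proof.
move=> R00 cH ch dH.
rewrite integral_mkcond -integral21_prod_meas1/=; last first.
  apply/integrable_restrict => //; first exact: measurable_Q.
  by rewrite setTI; exact: integrable_Q.
rewrite [RHS]integral_mkcond; apply: eq_integral => t _.
rewrite /fubini_G patchE; case: ifPn => [|tT]; last first.
  rewrite integral0_eq// => x _; rewrite patchE ifF//.
  by apply/negbTE; apply: contra tT; rewrite !inE => -[].
rewrite inE => tT.
transitivity (\int[@lebesgue_measure R]_(x in `]0%R, R0[) (h (x, t))%:E)%E.
  rewrite [RHS]integral_mkcond; apply: eq_integral => x _.
  rewrite !patchE; congr (if _ then _ else _).
  by apply/idP/idP; rewrite !inE; [case|move=> ?; split].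
apply: (@FTC_open_itv R 0 R0 (fun x => H (x, t)) (fun x => h (x, t)) R00).
- by apply: (continuous_slice1 cH); exact: subset_itv_oo_cc.
- by apply: (continuous_slice1 ch); exact: subset_itv_oo_cc.
- by move=> x xR; apply: dH.
Qed.

Lemma integral_dt (R : realType) (R0 T : R) (F f : R * R -> R) : 0 < T ->
  {within Qbar R0 T, continuous F} -> {within Qbar R0 T, continuous f} ->
  (forall x t, x \in `]0, R0[ -> t \in `]0, T[ ->
     is_derive t 1 (fun r => F (x, r)) (f (x, t))) ->
  (forall x, x \in `]0, R0[ -> F (x, 0) = 0 /\ F (x, T) = 0) ->
  (\int[(@lebesgue_measure R \x @lebesgue_measure R)]_(z in Q R0 T) (f z)%:E
   = 0)%E.
Proof.
move=> T0 cF cf dF F0.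
rewrite integral_mkcond -integral12_prod_meas1/=; last first.
  apply/integrable_restrict => //; first exact: measurable_Q.
  by rewrite setTI; exact: integrable_Q.
rewrite integral0_eq// => x _; rewrite /fubini_F.
have [xR|xR] := boolP (x \in `]0, R0[); last first.
  rewrite integral0_eq// => t _; rewrite patchE ifF//.
  by apply/negbTE; apply: contra xR; rewrite !inE => -[].
have [F00 FT0] := F0 _ xR.
transitivity (F (x, T) - F (x, 0))%:E; last by rewrite F00 FT0 subr0.
transitivity (\int[@lebesgue_measure R]_(t in `]0%R, T[) (f (x, t))%:E)%E.
  rewrite [RHS]integral_mkcond; apply: eq_integral => t _.
  rewrite !patchE; congr (if _ then _ else _).
  by apply/idP/idP; rewrite !inE; [case|move=> ?; split].
apply: (@FTC_open_itv R 0 T (fun t => F (x, t)) (fun t => f (x, t)) T0).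
- by apply: (continuous_slice2 cF); exact: subset_itv_oo_cc.
- by apply: (continuous_slice2 cf); exact: subset_itv_oo_cc.
- by move=> t tT; apply: dF.
Qed.

(** * Interior derivatives and the symmetry of mixed derivatives *)

(** Near an interior point the relative difference quotient is the ordinary
    one; Caratheodory's criterion turns its limit into a derivative. *)
Lemma is_derive_within (R : realType) (a b x : R) (f : R -> R) :
  x \in `]a, b[ -> derivable_within `[a, b] f x ->
  is_derive x 1 f (derive_within `[a, b] f x).
Proof.
move=> xab cf; apply/is_derive1_caratheodory.
set l := derive_within _ _ _.
exists (fun y => if y == x then l else diff_quot f x y).
split; last by rewrite eqxx.
  move=> y; case: eqP => [->|/eqP yx]; first by rewrite !subrr mulr0.
  by rewrite /diff_quot divfK// subr_eq0.
apply/cvgrPdist_lt => e e0; rewrite eqxx.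
have nb : \forall y \near x, y != x -> y \in `[a, b] ->
    `|l - diff_quot f x y| < e.
  by have /cvgrPdist_lt := cf; apply.
near=> y.
have ynb : y != x -> y \in `[a, b] -> `|l - diff_quot f x y| < e by near: y.
have yab : y \in `]a, b[ by near: y; exact: near_in_itvoo.
case: eqP => [_|/eqP yx]; first by rewrite subrr normr0.
by apply: ynb => //; exact: subset_itv_oo_cc.
Unshelve. all: by end_near. Qed.

Lemma is_derive_near0 (R : realType) (a b x l : R) (f : R -> R) :
  x \in `]a, b[ -> (forall y, y \in `]a, b[ -> f y = 0) ->
  is_derive x 1 f l -> l = 0.
Proof.
move=> xab f0 df.
have d0 : is_derive x 1 (cst 0 : R -> R) l.
  apply: near_eq_is_derive df => //.
  by apply: filterS (near_in_itvoo xab) => y /f0.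
by have [_ <-] := d0; rewrite derive_cst.
Qed.

(** The mixed second difference of f, divided by h^2, is a value of the mixed
    derivative: the mean value theorem is applied in the first variable to the
    increment of f in the second one, and then in the second variable. *)
Lemma mixed_difference_mvt (R : realType) (f f1 f12 : R * R -> R) (x y h : R) :
  0 < h ->
  (forall a b, a \in `[x, x + h] -> b \in `[y, y + h] ->
    is_derive a 1 (fun r => f (r, b)) (f1 (a, b)) /\
    is_derive b 1 (fun r => f1 (a, r)) (f12 (a, b))) ->
  exists a b, [/\ a \in `]x, x + h[, b \in `]y, y + h[ &
    f (x + h, y + h) - f (x + h, y) - f (x, y + h) + f (x, y) =
    f12 (a, b) * h * h].
Proof.
move=> h0 df.
have cc (z : R) : z \in `[z, z + h] /\ z + h \in `[z, z + h].
  by rewrite !in_itv/= !lexx lerDl ltW.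
have lth (z : R) : z < z + h by rewrite ltrDl.
have oc (z r : R) : r \in `]z, z + h[ -> r \in `[z, z + h].
  exact: subset_itv_oo_cc.
pose u r := f (r, y + h) - f (r, y).
have du a : a \in `[x, x + h] ->
    is_derive a 1 u (f1 (a, y + h) - f1 (a, y)).
  move=> ax; apply: is_deriveB.
    by have [] := df a (y + h) ax (cc y).2.
  by have [] := df a y ax (cc y).1.
have cu : {within `[x, x + h], continuous u}.
  by apply: derivable_within_continuous => a /du [].
have [a ax ua] := MVT (lth x) (fun a ax => du a (oc _ _ ax)) cu.
have dfa b : b \in `[y, y + h] ->
    is_derive b 1 (fun r => f1 (a, r)) (f12 (a, b)).
  by move=> /(df a b (oc _ _ ax))[].
have cf1 : {within `[y, y + h], continuous (fun r => f1 (a, r))}.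
  by apply: derivable_within_continuous => b /dfa [].
have [b by_ fb] := MVT (lth y) (fun b yb => dfa b (oc _ _ yb)) cf1.
exists a, b; split => //.
move: ua; rewrite fb /u ![_ + h - _]addrAC !subrr !add0r => <-; ring.
Qed.

(** The second difference over a small square is symmetric in the variables, so
    by [mixed_difference_mvt] both mixed derivatives take, at points of that
    square, the same value; continuity at the corner concludes. *)
Lemma mixed_partials_eq (R : realType) (D : set (R * R))
    (f f1 f2 f12 f21 : R * R -> R) (z : R * R) :
  open D -> D z ->
  (forall a b, D (a, b) ->
    [/\ is_derive a 1 (fun r => f (r, b)) (f1 (a, b)),
        is_derive b 1 (fun r => f (a, r)) (f2 (a, b)),
        is_derive b 1 (fun r => f1 (a, r)) (f12 (a, b)) &
        is_derive a 1 (fun r => f2 (r, b)) (f21 (a, b))]) ->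
  {for z, continuous f12} -> {for z, continuous f21} -> f12 z = f21 z.
Proof.
case: z => x y oD Dz df cf12 cf21.
apply/eqP; rewrite -subr_eq0 -normr_le0.
apply/ler_addgt0Pl => e e0; rewrite addr0.
have e20 : 0 < e / 2 by rewrite divr_gt0.
have /nbhs_ballP[r /= r0 rP] : \forall p \near (x, y),
    [/\ D p, `|f12 (x, y) - f12 p| < e / 2 & `|f21 (x, y) - f21 p| < e / 2].
  have n1 := open_nbhs_nbhs (conj oD Dz).
  have n2 : \forall p \near (x, y), `|f12 (x, y) - f12 p| < e / 2.
    by have /cvgrPdist_lt := cf12; apply.
  have n3 : \forall p \near (x, y), `|f21 (x, y) - f21 p| < e / 2.
    by have /cvgrPdist_lt := cf21; apply.
  by apply: filterS3 n1 n2 n3 => p.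
have h0 : 0 < r / 2 by rewrite divr_gt0.
have hr : r / 2 < r by rewrite ltr_pdivrMr// ltr_pMr// ltr1n.
have inball (u a : R) : a \in `[u, u + r / 2] -> ball u r a.
  rewrite in_itv/= => /andP[ua au]; rewrite -ball_normE /ball_/= distrC.
  by rewrite ger0_norm ?subr_ge0// ltrBlDl (le_lt_trans au)// ltrD2l.
have ocw (u a : R) : a \in `]u, u + r / 2[ -> a \in `[u, u + r / 2].
  exact: subset_itv_oo_cc.
have inP a b : a \in `[x, x + r / 2] -> b \in `[y, y + r / 2] ->
    [/\ D (a, b), `|f12 (x, y) - f12 (a, b)| < e / 2 &
        `|f21 (x, y) - f21 (a, b)| < e / 2].
  by move=> /inball xa /inball yb; apply: rP.
have [a [b [ax by_ E1]]] := @mixed_difference_mvt R f f1 f12 x y (r / 2) h0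
  (fun a b ax by_ => let: And3 Dab _ _ := inP a b ax by_ in
     let: And4 d1 _ d3 _ := df a b Dab in conj d1 d3).
have [b' [a' [by' ax' E2]]] := @mixed_difference_mvt R
  (fun p => f (p.2, p.1)) (fun p => f2 (p.2, p.1)) (fun p => f21 (p.2, p.1))
  y x (r / 2) h0
  (fun b a by_ ax => let: And3 Dab _ _ := inP a b ax by_ in
     let: And4 _ d2 _ d4 := df a b Dab in conj d2 d4).
have E : f12 (a, b) = f21 (a', b').
  apply: (mulIf (lt0r_neq0 h0)); apply: (mulIf (lt0r_neq0 h0)).
  by rewrite -E1 -E2 /=; ring.
have [_ k1 _] := inP a b (ocw _ _ ax) (ocw _ _ by_).
have [_ _ k2] := inP a' b' (ocw _ _ ax') (ocw _ _ by').
have -> : f12 (x, y) - f21 (x, y) =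
   (f12 (x, y) - f12 (a, b)) - (f21 (x, y) - f21 (a', b')) by rewrite E; ring.
rewrite (le_trans (ler_normB _ _))// (splitr e) lerD// ltW//.
Qed.

(** * The multiplier identity and the pointwise estimate *)

(** In this part s > 0 is the large parameter, m = - lambda, p = phi, and the
    letters Y and y refer to the rescaled time tau = c t; A and B are as above,
    e = exp (- s p), and W, X, Y stand for e v and its two derivatives. *)
Section PointwiseIdentity.
Context (R : realType).
Implicit Types s m A B p e v vx vy W X Y XX XY YY : R.

(** [fluxX] and [fluxY] are the components of the energy flux of W contracted
    with the multiplier field (phi_tau, - phi_x), together with the flux of the
    potential s^2 (phi_tau^2 - phi_x^2); here
    phi_tau^2 - phi_x^2 = m^2 p^2 (A^2 + 2 A B). *)
Definition fluxX s m A B p W X Y : R :=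
  s * m * p * B * (X * X + Y * Y) - 2 * s * m * p * (A + B) * X * Y
  - s ^+ 3 * m ^+ 3 * (p * p * p) * (A * A + 2 * A * B) * B * (W * W).

Definition fluxY s m A B p W X Y : R :=
  s * m * p * (A + B) * (X * X + Y * Y) - 2 * s * m * p * B * X * Y
  + s ^+ 3 * m ^+ 3 * (p * p * p) * (A * A + 2 * A * B) * (A + B) * (W * W).

(** The chain rule applied to [fluxX] along x, and below to [fluxY] along tau:
    B has derivative - B^2 in both directions, A has derivative - A^2 along tau
    and 0 along x. *)
Definition divX s m A B p W X Y XX XY : R :=
  s * m * (m - 1) * p * B ^+ 2 * (X ^+ 2 + Y ^+ 2)
  + 2 * s * m * p * B * (X * XX + Y * XY)
  - 2 * s * m * p * (m * B * (A + B) - B ^+ 2) * X * Y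
  - 2 * s * m * p * (A + B) * (X * XY + Y * XX)
  - s ^+ 3 * m ^+ 3 * p ^+ 3 * (3 * m * B ^+ 2 * (A ^+ 2 + 2 * A * B)
      - 2 * A * B ^+ 3 - (A ^+ 2 + 2 * A * B) * B ^+ 2) * W ^+ 2
  - 2 * s ^+ 3 * m ^+ 3 * p ^+ 3 * (A ^+ 2 + 2 * A * B) * B * W * X.

Definition divY s m A B p W X Y XY YY : R :=
  s * m * p * (m * (A + B) ^+ 2 - A ^+ 2 - B ^+ 2) * (X ^+ 2 + Y ^+ 2)
  + 2 * s * m * p * (A + B) * (X * XY + Y * YY)
  - 2 * s * m * p * (m * (A + B) * B - B ^+ 2) * X * Y
  - 2 * s * m * p * B * (X * YY + Y * XY)
  + s ^+ 3 * m ^+ 3 * p ^+ 3 * (3 * m * (A + B) ^+ 2 * (A ^+ 2 + 2 * A * B)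
      - (2 * A ^+ 3 + 2 * A ^+ 2 * B + 2 * A * B ^+ 2) * (A + B)
      - (A ^+ 2 + 2 * A * B) * (A ^+ 2 + B ^+ 2)) * W ^+ 2
  + 2 * s ^+ 3 * m ^+ 3 * p ^+ 3 * (A ^+ 2 + 2 * A * B) * (A + B) * W * Y.

(** What is left of P1 P2 once the divergence is removed; the Hessian of phi is
    already written in the null directions X + Y and Y - X. *)
Definition bulk s m A B p W X Y : R :=
  s * m * p / 2 * ((1 - m) * A ^+ 2 * (X + Y) ^+ 2
    + ((1 - m) * (A ^+ 2 + 4 * B ^+ 2) - 4 * m * A * B) * (Y - X) ^+ 2)
  + s ^+ 3 * m ^+ 3 * p ^+ 3 * ((A ^+ 2 + 2 * A * B) * A ^+ 2
    + 2 * A ^+ 2 * (A ^+ 2 + 2 * A * B + 2 * B ^+ 2)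
    - 3 * m * (A ^+ 2 + 2 * A * B) ^+ 2) * W ^+ 2.

Lemma multiplier_identity s m A B p W X Y XX XY YY :
  (YY - XX + s ^+ 2 * m ^+ 2 * p ^+ 2 * (A ^+ 2 + 2 * A * B) * W) *
    (2 * s * m * p * ((A + B) * Y - B * X)) =
  bulk s m A B p W X Y
  + divX s m A B p W X Y XX XY + divY s m A B p W X Y XY YY.
Proof. by rewrite /bulk /divX /divY; field. Qed.

(** For m <= 1/3 the second null coefficient is at least
    2/3 (A^2 - 2 A B + 4 B^2), whose minimum over B is A^2 / 2. In the W^2
    coefficient the negative term is at most (A^2 + 2 A B)^2, and what remains
    is 2 A^4 + 2 A^3 B. *)
Lemma bulk_ge s m A B p W X Y : 0 < s -> 0 < m -> m < 1 / 3 -> 0 < p ->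
  0 < B -> B <= A ->
  s * m * p * (A ^+ 2 / 2) * (X ^+ 2 + Y ^+ 2)
  + 2 * s ^+ 3 * m ^+ 3 * p ^+ 3 * A ^+ 4 * W ^+ 2 <= bulk s m A B p W X Y.
Proof.
move=> s0 m0 m3 p0 B0 BA; rewrite /bulk.
have A0 : 0 < A by lra.
have c1 : A ^+ 2 / 2 <= (1 - m) * A ^+ 2.
  have := sqr_ge0 A; nra.
have c2 : A ^+ 2 / 2 <= (1 - m) * (A ^+ 2 + 4 * B ^+ 2) - 4 * m * A * B.
  have AB : 0 < A * B by exact: mulr_gt0.
  have h1 : 2 / 3 * (A ^+ 2 + 4 * B ^+ 2) <= (1 - m) * (A ^+ 2 + 4 * B ^+ 2).
    by apply: ler_wpM2r; [have := sqr_ge0 A; have := sqr_ge0 B; lra|lra].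
  have h2 : 4 * m * (A * B) <= 4 / 3 * (A * B).
    by apply: ler_wpM2r; lra.
  (* A^2 - 2 A B + 4 B^2 = 3/4 A^2 + (A/2 - 2 B)^2. *)
  have := sqr_ge0 (A / 2 - 2 * B); nra.
have c3 : 2 * A ^+ 4 <= (A ^+ 2 + 2 * A * B) * A ^+ 2
    + 2 * A ^+ 2 * (A ^+ 2 + 2 * A * B + 2 * B ^+ 2)
    - 3 * m * (A ^+ 2 + 2 * A * B) ^+ 2.
  have h : 3 * m * (A ^+ 2 + 2 * A * B) ^+ 2 <= (A ^+ 2 + 2 * A * B) ^+ 2.
    by rewrite ler_piMl ?sqr_ge0//; lra.
  have : 0 <= A ^+ 3 * B by rewrite mulr_ge0// ?exprn_ge0// ltW.
  nra.
apply: lerD.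
  rewrite [leLHS](_ : _ = s * m * p / 2 * (A ^+ 2 / 2 * (X + Y) ^+ 2
    + A ^+ 2 / 2 * (Y - X) ^+ 2)); last by field.
  apply: ler_wpM2l.
    by rewrite !mulr_ge0// ltW.
  by apply: lerD; apply: ler_wpM2r; rewrite ?sqr_ge0.
rewrite [leLHS](_ : _ = s ^+ 3 * m ^+ 3 * p ^+ 3 * (2 * A ^+ 4) * W ^+ 2);
  last by ring.
apply: ler_wpM2r; first exact: sqr_ge0.
apply: ler_wpM2l => //; apply: mulr_ge0; last exact/exprn_ge0/ltW.
by apply: mulr_ge0; exact/exprn_ge0/ltW.
Qed.


(** The order zero remainder is s times the wave operator applied to phi, times
    W. The bracket lies between 0 and A^2, and s m p >= 1 trades the square for
    a cube, which is half of the W^2 term in [bulk_ge]. *)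
Lemma remainder_le s m A B p W : 0 < m -> m < 1 / 3 -> 0 < B -> B <= A ->
  0 < p -> 1 <= s * m * p ->
  (s * m * p * ((1 - m) * A ^+ 2 - 2 * m * A * B) * W) ^+ 2 <=
  s ^+ 3 * m ^+ 3 * p ^+ 3 * A ^+ 4 * W ^+ 2.
Proof.
move=> m0 m3 B0 BA p0 smp.
have A0 : 0 < A by lra.
set k := s * m * p in smp *; set d := (1 - m) * A ^+ 2 - 2 * m * A * B.
have AB : A * B <= A ^+ 2 by rewrite expr2 ler_pM2l.
have AB0 : 0 < A * B by exact: mulr_gt0.
have mAB : m * (A * B) <= m * A ^+ 2 by rewrite ler_pM2l.
have mAB0 : 0 < m * (A * B) by exact: mulr_gt0.
have m3A : 3 * m * A ^+ 2 <= A ^+ 2 by rewrite ler_piMl ?sqr_ge0//; lra.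
have d0 : 0 <= d by rewrite /d; nra.
have dA : d <= A ^+ 2 by rewrite /d; nra.
have d2 : d ^+ 2 <= A ^+ 4.
  by rewrite (_ : A ^+ 4 = (A ^+ 2) ^+ 2) ?lerXn2r ?nnegrE ?sqr_ge0// -exprM.
rewrite (_ : (k * d * W) ^+ 2 = k ^+ 2 * (d ^+ 2 * W ^+ 2)); last by ring.
rewrite [leRHS](_ : _ = k ^+ 3 * (A ^+ 4 * W ^+ 2)); last by rewrite /k; ring.
have k23 : k ^+ 2 <= k ^+ 3 by rewrite (exprS k) ler_peMl ?sqr_ge0.
have dW : d ^+ 2 * W ^+ 2 <= A ^+ 4 * W ^+ 2 by rewrite ler_wpM2r ?sqr_ge0.
exact: ler_pM (sqr_ge0 k) (mulr_ge0 (sqr_ge0 d) (sqr_ge0 W)) k23 dW.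
Qed.

Lemma shift_le s m A B p W : 0 < m -> m < 1 / 3 -> 0 < B -> B <= A ->
  A <= 1 ->
  (s * m * p * B * W) ^+ 2 <= s ^+ 2 * p ^+ 2 * W ^+ 2 /\
  (s * m * p * (A + B) * W) ^+ 2 <= 4 * (s ^+ 2 * p ^+ 2 * W ^+ 2).
Proof.
move=> m0 m3 B0 BA A1.
have V0 : 0 <= s ^+ 2 * p ^+ 2 * W ^+ 2.
  by rewrite mulr_ge0 ?sqr_ge0// mulr_ge0// sqr_ge0.
split.
  rewrite (_ : _ ^+ 2 = (s ^+ 2 * p ^+ 2 * W ^+ 2) * (m * B) ^+ 2);
    last by ring.
  by rewrite ler_piMr// exprn_ile1//; nra.
rewrite (_ : _ ^+ 2 =
  4 * (s ^+ 2 * p ^+ 2 * W ^+ 2) * (m * ((A + B) / 2)) ^+ 2); last by field.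
rewrite ler_piMr//; first exact: mulr_ge0.
by rewrite exprn_ile1//; nra.
Qed.

(** [conjX] and [conjY] are e times (d - s d phi) v, that is, the derivatives of
    e v along x and tau; [conjXX], [conjXY] and [conjYY] are its second
    derivatives. *)
Definition conjX s m B p e v vx : R := e * (vx - s * m * p * B * v).

Definition conjY s m A B p e v vy : R := e * (vy - s * m * p * (A + B) * v).

Definition conjXX s m B p e v vx vxx : R :=
  e * (vxx - 2 * s * m * p * B * vx
       + (s ^+ 2 * m ^+ 2 * p ^+ 2 * B ^+ 2
          + s * m * (1 - m) * p * B ^+ 2) * v).

Definition conjXY s m A B p e v vx vy vxy : R :=
  e * (vxy - s * m * p * B * vy - s * m * p * (A + B) * vx
       + (s ^+ 2 * m ^+ 2 * p ^+ 2 * (A + B) * B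
          - s * p * (m ^+ 2 * (A + B) * B - m * B ^+ 2)) * v).

Definition conjYY s m A B p e v vy vyy : R :=
  e * (vyy - 2 * s * m * p * (A + B) * vy
       + (s ^+ 2 * m ^+ 2 * p ^+ 2 * (A + B) ^+ 2
          - s * p * (m ^+ 2 * (A + B) ^+ 2 - m * (A ^+ 2 + B ^+ 2))) * v).

Lemma gradient_le s m A B p e v vx vy : 0 < m -> m < 1 / 3 ->
  0 < B -> B <= A -> A <= 1 ->
  e ^+ 2 * (vx ^+ 2 + vy ^+ 2) <=
  2 * (conjX s m B p e v vx ^+ 2 + conjY s m A B p e v vy ^+ 2)
  + 10 * s ^+ 2 * p ^+ 2 * (e * v) ^+ 2.
Proof.
move=> m0 m3 B0 BA A1.
have [hB hAB] := @shift_le s m A B p (e * v) m0 m3 B0 BA A1.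
set X := conjX _ _ _ _ _ _ _; set Y := conjY _ _ _ _ _ _ _ _.
set W := e * v in hB hAB *.
have ex : e * vx = X + s * m * p * B * W by rewrite /X /conjX /W; ring.
have ey : e * vy = Y + s * m * p * (A + B) * W by rewrite /Y /conjY /W; ring.
have sq2 (a b : R) : (a + b) ^+ 2 <= 2 * a ^+ 2 + 2 * b ^+ 2.
  by have := sqr_ge0 (a - b); nra.
rewrite (_ : _ * _ = (e * vx) ^+ 2 + (e * vy) ^+ 2); last by ring.
have := sq2 X (s * m * p * B * W); have := sq2 Y (s * m * p * (A + B) * W).
rewrite ex ey; lra.
Qed.

Lemma conjugated_wave s m A B p e v vx vy vxx vyy :
  let W := e * v in
  let X := conjX s m B p e v vx in
  let Y := conjY s m A B p e v vy in
  e * (vyy - vxx) =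
  (conjYY s m A B p e v vy vyy - conjXX s m B p e v vx vxx
   + s ^+ 2 * m ^+ 2 * p ^+ 2 * (A ^+ 2 + 2 * A * B) * W)
  + 2 * s * m * p * ((A + B) * Y - B * X)
  - s * m * p * ((1 - m) * A ^+ 2 - 2 * m * A * B) * W.
Proof. by rewrite /conjX /conjY /conjXX /conjYY /=; ring. Qed.

(** The integrand of the Carleman estimate: on the right, the divergence
    integrates to boundary terms. The lower bound a on A is the only
    information on the position that enters the constant. *)
Lemma pointwise_carleman s m A B p e v vx vy vxx vyy vxy c a :
  0 < m -> m < 1 / 3 -> 0 < a -> a <= A -> 0 < B -> B <= A -> A <= 1 ->
  1 <= p -> 1 <= s * m ->
  m ^+ 3 * a ^+ 4 / (20 * (1 + c ^+ 2)) *
    (e ^+ 2 * (s ^+ 3 * p ^+ 3 * v ^+ 2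
               + s * ((c * vy) ^+ 2 + vx ^+ 2))) <=
  e ^+ 2 * (vyy - vxx) ^+ 2
  - divX s m A B p (e * v) (conjX s m B p e v vx) (conjY s m A B p e v vy)
      (conjXX s m B p e v vx vxx) (conjXY s m A B p e v vx vy vxy)
  - divY s m A B p (e * v) (conjX s m B p e v vx) (conjY s m A B p e v vy)
      (conjXY s m A B p e v vx vy vxy) (conjYY s m A B p e v vy vyy).
Proof.
move=> m0 m3 a0 aA B0 BA A1 p1 sm.
set X := conjX _ _ _ _ _ _ _; set Y := conjY _ _ _ _ _ _ _ _.
set XX := conjXX _ _ _ _ _ _ _ _; set XY := conjXY _ _ _ _ _ _ _ _ _ _.
set YY := conjYY _ _ _ _ _ _ _ _ _.
have s0 : 0 < s by nra.
have p0 : 0 < p by lra.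
have smp : 1 <= s * m * p by rewrite -[1]mulr1 ler_pM.
set W := e * v.
have HN := conjugated_wave s m A B p e v vx vy vxx vyy.
rewrite /= -/X -/Y -/XX -/YY -/W in HN.
have HM := multiplier_identity s m A B p W X Y XX XY YY.
have Hb := @bulk_ge s m A B p W X Y s0 m0 m3 p0 B0 BA.
have HR := @remainder_le s m A B p W m0 m3 B0 BA p0 smp.
have HG := @gradient_le s m A B p e v vx vy m0 m3 B0 BA A1.
rewrite -/X -/Y -/W in HG.
set P1 := YY - XX + _ in HN HM.
set P2 := 2 * s * m * p * _ in HN HM.
set Rm := s * m * p * ((1 - m) * A ^+ 2 - 2 * m * A * B) * W in HN HR.
have H2 : P1 * P2 <= e ^+ 2 * (vyy - vxx) ^+ 2 + Rm ^+ 2.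
  (* 4 P1 P2 <= (P1 + P2)^2, and P1 + P2 is the source plus Rm. *)
  rewrite -exprMn HN; have := sqr_ge0 (P1 - P2).
  have := sqr_ge0 (P1 + P2 - 2 * Rm); nra.
suff H3 : m ^+ 3 * a ^+ 4 / (20 * (1 + c ^+ 2)) *
    (e ^+ 2 * (s ^+ 3 * p ^+ 3 * v ^+ 2 + s * ((c * vy) ^+ 2 + vx ^+ 2))) <=
    s * m * p * (A ^+ 2 / 2) * (X ^+ 2 + Y ^+ 2)
    + s ^+ 3 * m ^+ 3 * p ^+ 3 * A ^+ 4 * W ^+ 2.
  by rewrite HM in H2; lra.
have c1 : 0 < 1 + c ^+ 2 by have := sqr_ge0 c; lra.
set K := m ^+ 3 * a ^+ 4 / (20 * (1 + c ^+ 2)).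
have K0 : 0 <= K.
  by rewrite divr_ge0 ?mulr_ge0 ?exprn_ge0// ltW.
have KE : K * (1 + c ^+ 2) = m ^+ 3 * a ^+ 4 / 20.
  by rewrite /K; field; rewrite gt_eqF.
have aA4 : a ^+ 4 <= A ^+ 4.
  by rewrite lerXn2r ?nnegrE ?(ltW a0)// ltW// (lt_le_trans a0).
have A0 : 0 < A by lra.
have m1 : m <= 1 by lra.
have A42 : A ^+ 4 <= A ^+ 2.
  have -> : A ^+ 4 = A ^+ 2 * A ^+ 2 by ring.
  apply: ler_piMl; first exact: sqr_ge0.
  by apply: exprn_ile1 => //; exact: ltW.
have m31 : m ^+ 3 <= m.
  rewrite (exprS m 2); apply: ler_piMr; first exact: ltW.
  by apply: exprn_ile1 => //; exact: ltW.
have m3A4 : m ^+ 3 * a ^+ 4 <= m ^+ 3 * A ^+ 4.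
  by rewrite ler_wpM2l// exprn_ge0// ltW.
have KB : K * (1 + c ^+ 2) <= m ^+ 3 * A ^+ 4 / 20.
  by rewrite KE ler_wpM2r// invr_ge0.
have KA : K * (1 + c ^+ 2) <= m * p * A ^+ 2 / 20.
  rewrite KE ler_wpM2r ?invr_ge0//; apply: (le_trans m3A4).
  have mA : m ^+ 3 * A ^+ 4 <= m * A ^+ 2.
    by rewrite ler_pM ?exprn_ge0// ltW.
  have : 0 <= m * A ^+ 2 by rewrite mulr_ge0 ?sqr_ge0// ltW.
  nra.
have p23 : p ^+ 2 <= p ^+ 3 by rewrite (exprS p 2) ler_peMl ?sqr_ge0.
(* Back from W to v: the gradient of v costs (1 + c^2) times the gradient of W
   and ten times the W^2 term, whence the factor 20 in the constant. *)
set G := X ^+ 2 + Y ^+ 2 in HG *.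
have G0 : 0 <= G by rewrite addr_ge0 ?sqr_ge0.
have V1 : e ^+ 2 * ((c * vy) ^+ 2 + vx ^+ 2) <=
    (1 + c ^+ 2) * (2 * G + 10 * (s ^+ 2 * p ^+ 3 * W ^+ 2)).
  apply: (@le_trans _ _ ((1 + c ^+ 2) * (e ^+ 2 * (vx ^+ 2 + vy ^+ 2)))).
    have h1 : 0 <= e ^+ 2 * vy ^+ 2 by rewrite mulr_ge0 ?sqr_ge0.
    have h2 : 0 <= c ^+ 2 * (e ^+ 2 * vx ^+ 2).
      by rewrite mulr_ge0 ?sqr_ge0// mulr_ge0 ?sqr_ge0.
    by rewrite exprMn; lra.
  apply: ler_wpM2l; first exact: ltW.
  apply: (le_trans HG); rewrite lerD2l.
  have h : s ^+ 2 * p ^+ 2 * W ^+ 2 <= s ^+ 2 * p ^+ 3 * W ^+ 2.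
    by rewrite ler_wpM2r ?sqr_ge0// ler_wpM2l ?sqr_ge0.
  by lra.
set V := s ^+ 3 * p ^+ 3 * W ^+ 2.
have V0 : 0 <= V.
  by rewrite mulr_ge0 ?sqr_ge0// mulr_ge0 ?exprn_ge0// ltW.
have KV : K * V <= K * (1 + c ^+ 2) * V.
  by rewrite -mulrA ler_wpM2l// ler_peMl//; have := sqr_ge0 c; lra.
have sG0 : 0 <= s * G by rewrite mulr_ge0// ltW.
have T1 : K * (1 + c ^+ 2) * (s * G) <= m * p * A ^+ 2 / 20 * (s * G).
  exact: ler_wpM2r.
have T2 : K * (1 + c ^+ 2) * V <= m ^+ 3 * A ^+ 4 / 20 * V.
  exact: ler_wpM2r.
have T3 : K * (s * (e ^+ 2 * ((c * vy) ^+ 2 + vx ^+ 2))) <=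
    2 * (K * (1 + c ^+ 2) * (s * G)) + 10 * (K * (1 + c ^+ 2) * V).
  rewrite [leRHS](_ : _ = K * (s * ((1 + c ^+ 2) *
    (2 * G + 10 * (s ^+ 2 * p ^+ 3 * W ^+ 2))))); last by rewrite /V; ring.
  by apply: ler_wpM2l => //; apply: ler_wpM2l => //; exact: ltW.
rewrite [leLHS](_ : _ = K * V +
  K * (s * (e ^+ 2 * ((c * vy) ^+ 2 + vx ^+ 2)))); last by rewrite /V /W; ring.
rewrite [X in _ <= X + _](_ : _ = 10 * (m * p * A ^+ 2 / 20 * (s * G)));
  last by field.
rewrite [X in _ <= _ + X](_ : _ = 20 * (m ^+ 3 * A ^+ 4 / 20 * V));
  last by rewrite /V; field.
have R1 : 0 <= m * p * A ^+ 2 / 20 * (s * G).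
  by apply: (le_trans _ T1); rewrite mulr_ge0// mulr_ge0// ltW.
have R2 : 0 <= m ^+ 3 * A ^+ 4 / 20 * V.
  by apply: (le_trans _ T2); rewrite mulr_ge0// mulr_ge0// ltW.
by lra.
Qed.

End PointwiseIdentity.

(** As 3 m <= 1 and A, B <= 1, the flux is at most
    s p (X^2 + Y^2) + s^3 p^3 W^2; passing back to v costs the factor 2 and ten
    more copies of the last term, and c^-2 comes from vy = v_t / c. *)
Lemma fluxX_le (R : realType) (s m A B p e v vx vy c : R) :
  0 < s -> 0 < m -> m < 1 / 3 -> 0 < B -> B <= A -> A <= 1 -> 1 <= p ->
  c != 0 ->
  `|fluxX s m A B p (e * v) (conjX s m B p e v vx) (conjY s m A B p e v vy)|
  <= (11 + 2 * c ^- 2) *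
     (e ^+ 2 * (s ^+ 3 * p ^+ 3 * v ^+ 2
                + s * p * ((c * vy) ^+ 2 + vx ^+ 2))).
Proof.
move=> s0 m0 m3 B0 BA A1 p1 c0.
set W := e * v; set X := conjX _ _ _ _ _ _ _; set Y := conjY _ _ _ _ _ _ _ _.
have p0 : 0 < p by lra.
have sp0 : 0 < s * p by exact: mulr_gt0.
set G := X ^+ 2 + Y ^+ 2.
have sq2 (a b : R) : (a - b) ^+ 2 <= 2 * a ^+ 2 + 2 * b ^+ 2.
  by have := sqr_ge0 (a + b); nra.
have [hB hAB] := @shift_le _ s m A B p W m0 m3 B0 BA A1.
have GE : G <= 2 * (e ^+ 2 * (vx ^+ 2 + vy ^+ 2))
    + 10 * (s ^+ 2 * p ^+ 2 * W ^+ 2).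
  have XE : X = e * vx - s * m * p * B * W by rewrite /X /conjX /W; ring.
  have YE : Y = e * vy - s * m * p * (A + B) * W by rewrite /Y /conjY /W; ring.
  have := sq2 (e * vx) (s * m * p * B * W).
  have := sq2 (e * vy) (s * m * p * (A + B) * W).
  by rewrite -XE -YE /G; lra.
have G0 : 0 <= G by rewrite addr_ge0 ?sqr_ge0.
have mB : m * B <= 1 / 3.
  by apply: le_trans (ltW m3); rewrite ler_piMr ?(ltW m0)//; lra.
have mA : m * A <= 1 / 3.
  by apply: le_trans (ltW m3); rewrite ler_piMr ?(ltW m0)//; lra.
have mAB : m * (A + B) <= 2 / 3 by lra.
have mB0 : 0 < m * B by exact: mulr_gt0.
have mAB0 : 0 < m * (A + B) by apply: mulr_gt0 => //; lra.
have AB : A * B <= 1 by nra.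
have AB0 : 0 < A * B by apply: mulr_gt0 => //; lra.
have T1 : `|fluxX s m A B p W X Y| <=
    s * p * G + s ^+ 3 * p ^+ 3 * W ^+ 2.
  set k := m ^+ 3 * ((A ^+ 2 + 2 * A * B) * B).
  have k0 : 0 <= k.
    apply: mulr_ge0; first exact/exprn_ge0/ltW.
    by apply: mulr_ge0; [nra|exact: ltW].
  have k1 : k <= 1.
    have h1 : (A ^+ 2 + 2 * A * B) * B <= 3.
      have h : A ^+ 2 + 2 * A * B <= 3 by nra.
      nra.
    have h2 : m ^+ 3 <= (1 / 3) ^+ 3 by rewrite lerXn2r ?nnegrE// ltW//; lra.
    have h3 : 0 <= m ^+ 3 by exact/exprn_ge0/ltW.
    rewrite /k; nra.
  have V0 : 0 <= s ^+ 3 * p ^+ 3 * W ^+ 2.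
    by rewrite mulr_ge0 ?sqr_ge0// mulr_ge0// exprn_ge0// ltW.
  have kV : k * (s ^+ 3 * p ^+ 3 * W ^+ 2) <= s ^+ 3 * p ^+ 3 * W ^+ 2.
    by rewrite ler_piMl.
  have kV0 : 0 <= k * (s ^+ 3 * p ^+ 3 * W ^+ 2) by exact: mulr_ge0.
  have XY1 : `|2 * X * Y| <= G.
    rewrite ler_norml /G; have := sqr_ge0 (X - Y); have := sqr_ge0 (X + Y).
    by move=> ? ?; apply/andP; split; lra.
  have q1 : `|m * B * G - m * (A + B) * (2 * X * Y)| <= G.
    have : `|m * B * G - m * (A + B) * (2 * X * Y)| <=
      m * B * G + m * (A + B) * `|2 * X * Y|.
      rewrite (le_trans (ler_normB _ _))// !normrM.
      rewrite !(gtr0_norm m0) (gtr0_norm B0) (ger0_norm G0).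
      by rewrite (@gtr0_norm _ (A + B)) ?normrM//; lra.
    nra.
  have -> : fluxX s m A B p W X Y = s * p * (m * B * G -
      m * (A + B) * (2 * X * Y)) - k * (s ^+ 3 * p ^+ 3 * W ^+ 2).
    by rewrite /fluxX /k /G; ring.
  rewrite (le_trans (ler_normB _ _))// (ger0_norm kV0) lerD//.
  by rewrite normrM (gtr0_norm sp0) ler_wpM2l// ltW.
apply: (le_trans T1).
have c20 : 0 < c ^+ 2 by rewrite exprn_even_gt0.
set d := c ^- 2.
have d0 : 0 < d by rewrite invr_gt0.
have dc : d * (c * vy) ^+ 2 = vy ^+ 2.
  by rewrite exprMn mulrA /d mulVf ?mul1r// gt_eqF.
have h1 : s * p * G <= s * p * (2 * (e ^+ 2 * (vx ^+ 2 + vy ^+ 2))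
    + 10 * (s ^+ 2 * p ^+ 2 * W ^+ 2)) by rewrite ler_wpM2l// ltW.
have h2 : s * p * (e ^+ 2 * (vx ^+ 2 + vy ^+ 2)) <=
    s * p * (e ^+ 2 * ((1 + d) * ((c * vy) ^+ 2 + vx ^+ 2))).
  rewrite ler_wpM2l ?(ltW sp0)// ler_wpM2l ?sqr_ge0// -dc.
  have := sqr_ge0 (c * vy); have := sqr_ge0 vx; nra.
have h3 : 0 <= s * p * (e ^+ 2 * ((c * vy) ^+ 2 + vx ^+ 2)).
  by rewrite mulr_ge0 ?(ltW sp0)// mulr_ge0 ?sqr_ge0// addr_ge0 ?sqr_ge0.
have h4 : 0 <= d * (s ^+ 3 * p ^+ 3 * W ^+ 2).
  rewrite mulr_ge0 ?(ltW d0)// mulr_ge0 ?sqr_ge0// mulr_ge0//.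
    by rewrite exprn_ge0// ltW.
  by rewrite exprn_ge0// ltW.
have h5 : e ^+ 2 * (s ^+ 3 * p ^+ 3 * v ^+ 2
    + s * p * ((c * vy) ^+ 2 + vx ^+ 2)) = s ^+ 3 * p ^+ 3 * W ^+ 2 +
    s * p * (e ^+ 2 * ((c * vy) ^+ 2 + vx ^+ 2)) by rewrite /W; ring.
rewrite h5; nra.
Qed.

(** * Derivatives of the weight, of W and of the flux along the axes *)

(** Along a vertical line the variable is t itself, so that every derivative
    carries the factor c = d tau / d t. *)
Section LineDerivatives.
Context (R : realType).
Implicit Types (A B p e v vx vy W X Y : R -> R).
Implicit Types (x t c s m XX XY YY vxx vxy vyx vyy : R).

Lemma is_derive_fluxX A B p W X Y x s m XX XY :
  is_derive x 1 A 0 -> is_derive x 1 B (- B x ^+ 2) ->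
  is_derive x 1 p (m * p x * B x) ->
  is_derive x 1 W (X x) -> is_derive x 1 X XX -> is_derive x 1 Y XY ->
  is_derive x 1 (fun r => fluxX s m (A r) (B r) (p r) (W r) (X r) (Y r))
    (divX s m (A x) (B x) (p x) (W x) (X x) (Y x) XX XY).
Proof.
move=> dA dB dp dW dX dY; rewrite /fluxX.
by apply: is_derive_eq; rewrite /divX /GRing.scale /=; ring.
Qed.

Lemma is_derive_fluxY A B p W X Y t c s m XY YY :
  is_derive t 1 A (- c * A t ^+ 2) -> is_derive t 1 B (- c * B t ^+ 2) ->
  is_derive t 1 p (c * (m * p t * (A t + B t))) ->
  is_derive t 1 W (c * Y t) -> is_derive t 1 X (c * XY) ->
  is_derive t 1 Y (c * YY) ->
  is_derive t 1 (fun r => fluxY s m (A r) (B r) (p r) (W r) (X r) (Y r))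
    (c * divY s m (A t) (B t) (p t) (W t) (X t) (Y t) XY YY).
Proof.
move=> dA dB dp dW dX dY; rewrite /fluxY.
by apply: is_derive_eq; rewrite /divY /GRing.scale /=; ring.
Qed.

Lemma is_derive_conjx A B p e v vx vy x s m vxx vxy :
  is_derive x 1 A 0 -> is_derive x 1 B (- B x ^+ 2) ->
  is_derive x 1 p (m * p x * B x) ->
  is_derive x 1 e (- s * (m * p x * B x) * e x) ->
  is_derive x 1 v (vx x) -> is_derive x 1 vx vxx -> is_derive x 1 vy vxy ->
  [/\ is_derive x 1 (fun r => e r * v r)
        (conjX s m (B x) (p x) (e x) (v x) (vx x)),
      is_derive x 1 (fun r => conjX s m (B r) (p r) (e r) (v r) (vx r))
        (conjXX s m (B x) (p x) (e x) (v x) (vx x) vxx) &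
      is_derive x 1 (fun r => conjY s m (A r) (B r) (p r) (e r) (v r) (vy r))
        (conjXY s m (A x) (B x) (p x) (e x) (v x) (vx x) (vy x) vxy)].
Proof.
move=> dA dB dp de dv dvx dvy.
rewrite /conjX /conjY /conjXX /conjXY.
by split; apply: is_derive_eq; rewrite /GRing.scale /=; ring.
Qed.

Lemma is_derive_conjy A B p e v vx vy t c s m vxy vyy :
  is_derive t 1 A (- c * A t ^+ 2) -> is_derive t 1 B (- c * B t ^+ 2) ->
  is_derive t 1 p (c * (m * p t * (A t + B t))) ->
  is_derive t 1 e (- s * (c * (m * p t * (A t + B t))) * e t) ->
  is_derive t 1 v (c * vy t) -> is_derive t 1 vx (c * vxy) ->
  is_derive t 1 vy (c * vyy) ->
  [/\ is_derive t 1 (fun r => e r * v r)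
        (c * conjY s m (A t) (B t) (p t) (e t) (v t) (vy t)),
      is_derive t 1 (fun r => conjX s m (B r) (p r) (e r) (v r) (vx r))
        (c * conjXY s m (A t) (B t) (p t) (e t) (v t) (vx t) (vy t) vxy) &
      is_derive t 1 (fun r => conjY s m (A r) (B r) (p r) (e r) (v r) (vy r))
        (c * conjYY s m (A t) (B t) (p t) (e t) (v t) (vy t) vyy)].
Proof.
move=> dA dB dp de dv dvx dvy.
rewrite /conjX /conjY /conjYY /conjXY.
by split; apply: is_derive_eq; rewrite /GRing.scale /=; ring.
Qed.

End LineDerivatives.

Section Weight.
Context (R : realType).
Implicit Types (c lambda sigma x t : R) (z : R * R).

(** The functions A and B of the header: with phi they generate an algebra that
    is closed under both derivatives. *)
Definition invA c z : R := (1 + c * z.2)^-1.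
Definition invB c z : R := (1 + z.1 + c * z.2)^-1.
Definition weight c lambda sigma z : R := expR (- (sigma * phi c lambda z)).

Lemma is_derive_inv_affine (a b x : R) : a + b * x != 0 ->
  is_derive x 1 (fun r => (a + b * r)^-1) (- b * (a + b * x)^-1 ^+ 2).
Proof.
move=> abx.
have d : is_derive x 1 (fun r => a + b * r) b.
  by apply: is_derive_eq; rewrite /GRing.scale /=; ring.
apply: (is_derive_eq (@is_deriveV R (fun r => a + b * r) x b 1 abx d)).
by rewrite /GRing.scale /= -exprVn; ring.
Qed.

Lemma is_derive_ln_affine (a b x : R) : 0 < a + b * x ->
  is_derive x 1 (fun r => ln (a + b * r)) (b * (a + b * x)^-1).
Proof.
move=> abx.
have d : is_derive x 1 (fun r => a + b * r) b.
  by apply: is_derive_eq; rewrite /GRing.scale /=; ring.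
have dl := is_derive1_ln abx.
apply: (is_derive_eq (@is_derive1_comp R (@ln R) _ x _ _ dl d)).
by rewrite mulrC.
Qed.

Lemma weight_dx c lambda sigma x t : 0 < 1 + c * t -> 0 < 1 + x + c * t ->
  [/\ is_derive x 1 (fun r => invA c (r, t)) 0,
      is_derive x 1 (fun r => invB c (r, t)) (- invB c (x, t) ^+ 2),
      is_derive x 1 (fun r => phi c lambda (r, t))
        (- lambda * phi c lambda (x, t) * invB c (x, t)) &
      is_derive x 1 (fun r => weight c lambda sigma (r, t))
        (- sigma * (- lambda * phi c lambda (x, t) * invB c (x, t))
         * weight c lambda sigma (x, t))].
Proof.
move=> a0 b0.
have bE r : 1 + r + c * t = 1 + c * t + 1 * r by ring.
have b0' : 0 < 1 + c * t + 1 * x by rewrite -bE.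
have dphi : is_derive x 1 (fun r => phi c lambda (r, t))
    (- lambda * phi c lambda (x, t) * invB c (x, t)).
  rewrite /phi /psi /invB /=.
  under eq_fun do rewrite bE.
  have dl := is_derive_ln_affine b0'.
  have dp : is_derive x 1 (fun r => lambda * (- ln (1 + c * t)
      - ln (1 + c * t + 1 * r))) (- lambda * (1 + c * t + 1 * x)^-1).
    by apply: is_derive_eq; rewrite /GRing.scale /=; ring.
  apply: (is_derive_eq (is_derive1_comp (is_derive_expR _) dp)).
  by rewrite bE; ring.
split => //.
- by rewrite /invA /=; exact: is_derive_cst.
- rewrite /invB /=; under eq_fun do rewrite bE.
  apply: (is_derive_eq (is_derive_inv_affine (lt0r_neq0 b0'))).
  by rewrite bE; ring.
- rewrite /weight.
  have ds : is_derive x 1 (fun r => - (sigma * phi c lambda (r, t)))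
      (- sigma * (- lambda * phi c lambda (x, t) * invB c (x, t))).
    by apply: is_derive_eq; rewrite /GRing.scale /=; ring.
  by apply: (is_derive_eq (is_derive1_comp (is_derive_expR _) ds)); ring.
Qed.


Lemma weight_dt c lambda sigma x t : 0 < 1 + c * t -> 0 < 1 + x + c * t ->
  [/\ is_derive t 1 (fun r => invA c (x, r)) (- c * invA c (x, t) ^+ 2),
      is_derive t 1 (fun r => invB c (x, r)) (- c * invB c (x, t) ^+ 2),
      is_derive t 1 (fun r => phi c lambda (x, r))
        (c * (- lambda * phi c lambda (x, t)
              * (invA c (x, t) + invB c (x, t)))) &
      is_derive t 1 (fun r => weight c lambda sigma (x, r))
        (- sigma * (c * (- lambda * phi c lambda (x, t)
              * (invA c (x, t) + invB c (x, t))))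
         * weight c lambda sigma (x, t))].
Proof.
move=> a0 b0.
have dphi : is_derive t 1 (fun r => phi c lambda (x, r))
    (c * (- lambda * phi c lambda (x, t) * (invA c (x, t) + invB c (x, t)))).
  rewrite /phi /psi /invA /invB /=.
  have dl1 := is_derive_ln_affine a0.
  have dl2 := is_derive_ln_affine b0.
  have dp : is_derive t 1 (fun r => lambda * (- ln (1 + c * r)
      - ln (1 + x + c * r)))
      (- lambda * c * ((1 + c * t)^-1 + (1 + x + c * t)^-1)).
    by apply: is_derive_eq; rewrite /GRing.scale /=; ring.
  by apply: (is_derive_eq (is_derive1_comp (is_derive_expR _) dp)); ring.
split => //.
- exact: is_derive_inv_affine (lt0r_neq0 a0).
- exact: is_derive_inv_affine (lt0r_neq0 b0).
- rewrite /weight.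
  have ds : is_derive t 1 (fun r => - (sigma * phi c lambda (x, r)))
      (- sigma * (c * (- lambda * phi c lambda (x, t)
              * (invA c (x, t) + invB c (x, t))))).
    by apply: is_derive_eq; rewrite /GRing.scale /=; ring.
  by apply: (is_derive_eq (is_derive1_comp (is_derive_expR _) ds)); ring.
Qed.

End Weight.

(** * Continuity up to the boundary *)

Section WithinContinuity.
Context (R : realType) (T : topologicalType) (D : set T).
Implicit Types (f g : T -> R).

Lemma within_cst (k : R) : {within D, continuous (fun=> k)}.
Proof. by move=> z; exact: cvg_cst. Qed.

Lemma withinD f g : {within D, continuous f} -> {within D, continuous g} ->
  {within D, continuous (fun z => f z + g z)}.
Proof. by move=> cf cg z; exact: cvgD (cf z) (cg z). Qed.

Lemma withinN f : {within D, continuous f} ->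
  {within D, continuous (fun z => - f z)}.
Proof. by move=> cf z; exact: cvgN (cf z). Qed.

Lemma withinM f g : {within D, continuous f} -> {within D, continuous g} ->
  {within D, continuous (fun z => f z * g z)}.
Proof. by move=> cf cg z; exact: cvgM (cf z) (cg z). Qed.

Lemma withinZ (k : R) f : {within D, continuous f} ->
  {within D, continuous (fun z => k * f z)}.
Proof. by move=> cf; apply: withinM => //; exact: within_cst. Qed.

Lemma withinX f n : {within D, continuous f} ->
  {within D, continuous (fun z => f z ^+ n)}.
Proof.
move=> cf; elim: n => [|n IHn]; first exact: within_cst.
by under eq_fun do rewrite exprS; exact: withinM.
Qed.

Lemma within_comp f (h : R -> R) : {within D, continuous f} ->
  (forall z, D z -> {for f z, continuous h}) ->
  {within D, continuous (fun z => h (f z))}.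
Proof.
move=> /subspace_continuousP cf ch; apply/subspace_continuousP => z Dz.
by apply: cvg_comp (cf z Dz) _; exact: ch.
Qed.

End WithinContinuity.

(** Structural recursion on a polynomial expression whose atoms are continuous
    by hypothesis; the cases are matched on the syntax, since unification would
    unfold numerals and powers. *)
Ltac within_continuity := repeat
  lazymatch goal with
  | |- forall _, continuous_at _ (from_subspace _ (fun=> ?k)) =>
      exact: within_cst
  | |- forall _, continuous_at _
        (from_subspace _ (fun z => (@?f z + @?g z)%R)) =>
      refine (withinD (f := f) (g := g) _ _)
  | |- forall _, continuous_at _ (from_subspace _ (fun z => (- @?f z)%R)) =>
      refine (withinN (f := f) _)
  | |- forall _, continuous_at _
        (from_subspace _ (fun z => (@?f z * @?g z)%R)) =>
      refine (withinM (f := f) (g := g) _ _)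
  | |- forall _, continuous_at _ (from_subspace _ (fun z => (@?f z ^+ ?n)%R)) =>
      refine (withinX (f := f) (n := n) _)
  | |- _ => assumption
  end.

(** The next three lemmas are about arbitrary functions in place of the weight
    and the derivatives of v, so that continuity of the polynomials is decided
    without looking inside these. *)
Section WithinFluxes.
Context (R : realType) (U : topologicalType) (D : set U) (s m : R).
Implicit Types A B p e v vx vy vxx vxy vyy W X Y XX XY YY : U -> R.

Lemma within_conj A B p e v vx vy vxx vxy vyy :
  {within D, continuous A} -> {within D, continuous B} ->
  {within D, continuous p} -> {within D, continuous e} ->
  {within D, continuous v} -> {within D, continuous vx} ->
  {within D, continuous vy} -> {within D, continuous vxx} ->
  {within D, continuous vxy} -> {within D, continuous vyy} ->
  [/\ {within D, continuous (fun z =>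
        conjX s m (B z) (p z) (e z) (v z) (vx z))},
      {within D, continuous (fun z =>
        conjY s m (A z) (B z) (p z) (e z) (v z) (vy z))},
      {within D, continuous (fun z =>
        conjXX s m (B z) (p z) (e z) (v z) (vx z) (vxx z))},
      {within D, continuous (fun z =>
        conjXY s m (A z) (B z) (p z) (e z) (v z) (vx z) (vy z) (vxy z))} &
      {within D, continuous (fun z =>
        conjYY s m (A z) (B z) (p z) (e z) (v z) (vy z) (vyy z))}].
Proof.
by move=> *; split; rewrite /conjX /conjY /conjXX /conjXY /conjYY;
  within_continuity.
Qed.

Lemma within_flux A B p W X Y XX XY YY :
  {within D, continuous A} -> {within D, continuous B} ->
  {within D, continuous p} -> {within D, continuous W} ->
  {within D, continuous X} -> {within D, continuous Y} ->
  {within D, continuous XX} -> {within D, continuous XY} ->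
  {within D, continuous YY} ->
  [/\ {within D, continuous (fun z =>
        fluxX s m (A z) (B z) (p z) (W z) (X z) (Y z))},
      {within D, continuous (fun z =>
        fluxY s m (A z) (B z) (p z) (W z) (X z) (Y z))},
      {within D, continuous (fun z =>
        divX s m (A z) (B z) (p z) (W z) (X z) (Y z) (XX z) (XY z))} &
      {within D, continuous (fun z =>
        divY s m (A z) (B z) (p z) (W z) (X z) (Y z) (XY z) (YY z))}].
Proof.
by move=> *; split; rewrite /fluxX /fluxY /divX /divY; within_continuity.
Qed.

Lemma within_density (w p v q a b : U -> R) :
  {within D, continuous w} -> {within D, continuous p} ->
  {within D, continuous v} -> {within D, continuous q} ->
  {within D, continuous a} -> {within D, continuous b} ->
  {within D, continuous (fun z => w z ^+ 2 *
    (s ^+ 3 * p z ^+ 3 * v z ^+ 2 + q z * (a z ^+ 2 + b z ^+ 2)))}.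
Proof. by move=> *; apply: withinM; within_continuity. Qed.

End WithinFluxes.

Section WeightContinuity.
Context (R : realType) (c R0 T : R).
Hypothesis c0 : 0 < c.
Let D := Qbar R0 T.
Implicit Types z : R * R.

Lemma Qbar_denominators z : D z ->
  1 <= 1 + c * z.2 /\ 1 + c * z.2 <= 1 + z.1 + c * z.2.
Proof.
move=> [/=]; rewrite !in_itv/= => /andP[x0 _] /andP[t0 _].
by split; [rewrite lerDl mulr_ge0// ltW|lra].
Qed.

Lemma within_fst : {within D, continuous (fun z : R * R => z.1)}.
Proof. by apply: continuous_subspaceT => z; exact: cvg_fst. Qed.

Lemma within_snd : {within D, continuous (fun z : R * R => z.2)}.
Proof. by apply: continuous_subspaceT => z; exact: cvg_snd. Qed.

Lemma within_weight_factors lambda sigma :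
  [/\ {within D, continuous (invA c)}, {within D, continuous (invB c)},
      {within D, continuous (phi c lambda)} &
      {within D, continuous (weight c lambda sigma)}].
Proof.
have c1 := within_fst; have c2 := within_snd.
have ca : {within D, continuous (fun z => 1 + c * z.2)}.
  apply: withinD; first exact: within_cst.
  exact: withinZ.
have cb : {within D, continuous (fun z => 1 + z.1 + c * z.2)}.
  apply: withinD; first by apply: withinD => //; exact: within_cst.
  exact: withinZ.
have cphi : {within D, continuous (phi c lambda)}.
  apply: within_comp; last by move=> z _; exact: continuous_expR.
  apply: withinM; first exact: within_cst.
  apply: withinD; apply: withinN; apply: (@within_comp _ _ _ _ (@ln R)) => //.
  - move=> z /Qbar_denominators[h1 h2]; apply: continuous_ln; lra.
  - move=> z /Qbar_denominators[h1 h2]; apply: continuous_ln; lra.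
split => //.
- apply: (@within_comp _ _ _ _ (fun y => y^-1)) => // z.
  move=> /Qbar_denominators[h1 _].
  by apply: inv_continuous; rewrite gt_eqF//; lra.
- apply: (@within_comp _ _ _ _ (fun y => y^-1)) => // z.
  move=> /Qbar_denominators[h1 h2].
  by apply: inv_continuous; rewrite gt_eqF//; lra.
- apply: within_comp; last by move=> z _; exact: continuous_expR.
  by apply: withinN; exact: withinZ.
Qed.

End WeightContinuity.

(** * Smooth functions on the rectangle *)

Section Jets.
Context (R : realType) (R0 T : R) (v : R * R -> R).
Hypothesis sv : smooth_on_Qbar R0 T v.
Let D := Qbar R0 T.

Lemma smooth_dx : smooth_on_Qbar R0 T (dx R0 v).
Proof. by move=> k; have [_ [_ h _]] := sv k.+1. Qed.

Lemma smooth_dt : smooth_on_Qbar R0 T (dt T v).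
Proof. by move=> k; have [_ [_ _ h]] := sv k.+1. Qed.

Lemma smooth_within : {within D, continuous v}.
Proof. by have := sv 0; case. Qed.

Lemma smooth_is_derive x t : x \in `]0, R0[ -> t \in `]0, T[ ->
  is_derive x 1 (fun r => v (r, t)) (dx R0 v (x, t)) /\
  is_derive t 1 (fun r => v (x, r)) (dt T v (x, t)).
Proof.
move=> xR tT; have [_ [h _ _]] := sv 1.
have [|h1 h2] := h (x, t); first by split; exact: subset_itv_oo_cc.
by split; [exact: (is_derive_within xR h1)|exact: (is_derive_within tT h2)].
Qed.

End Jets.

Lemma open_Q (R : realType) (R0 T : R) : open (Q R0 T).
Proof.
have -> : Q R0 T = (fst @^-1` `]0, R0[) `&` (snd @^-1` `]0, T[) by [].
apply: openI; apply: open_comp; try exact: itv_open.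
- by move=> z _; exact: cvg_fst.
- by move=> z _; exact: cvg_snd.
Qed.

Lemma mixed_partials_smooth (R : realType) (R0 T x t : R) (v : R * R -> R) :
  smooth_on_Qbar R0 T v -> x \in `]0, R0[ -> t \in `]0, T[ ->
  dx R0 (dt T v) (x, t) = dt T (dx R0 v) (x, t).
Proof.
move=> sv xR tT.
have Qxt : Q R0 T (x, t) by split.
have sx := smooth_dx sv; have st := smooth_dt sv.
have int_cont (g : R * R -> R) : smooth_on_Qbar R0 T g ->
    {for (x, t), continuous g}.
  move=> /smooth_within cg.
  have := continuous_subspaceW (@subset_Q_Qbar R R0 T) cg.
  by rewrite continuous_open_subspace; [apply; rewrite inE|exact: open_Q].
apply/esym.
apply: (@mixed_partials_eq R (Q R0 T) v (dx R0 v) (dt T v) _ _ (x, t)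
  (@open_Q R R0 T) Qxt).
- move=> a b [/= aR bT].
  have [d1 d2] := smooth_is_derive sv aR bT.
  have [_ d3] := smooth_is_derive sx aR bT.
  have [d4 _] := smooth_is_derive st aR bT.
  by split; [exact: d1|exact: d2|exact: d3|exact: d4].
- by apply: int_cont; exact: smooth_dt.
- by apply: int_cont; exact: smooth_dx.
Qed.

(** The flux at t = 0 and t = T is reached as a limit from the interior, where
    the derivatives of v are two-sided and vanish with v. *)
Lemma within_slice_ends0 (R : realType) (a b d : R) (f : R -> R) :
  a < b -> 0 < d -> {within `[a, b], continuous f} ->
  (forall t, t \in `]a, b[ -> t < a + d \/ b - d < t -> f t = 0) ->
  f a = 0 /\ f b = 0.
Proof.
move=> ab d0 /(continuous_within_itvP _ ab)[_ fa fb] f0; split.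
  apply/esym; apply: cvg_unique fa; first exact: norm_hausdorff.
  apply: cvg_near_cst; near=> t; apply: f0.
    by rewrite in_itv/=; apply/andP; split; near: t;
      [exact: nbhs_right_gt|exact: nbhs_right_lt].
  by left; near: t; apply: nbhs_right_lt; lra.
apply/esym; apply: cvg_unique fb; first exact: norm_hausdorff.
apply: cvg_near_cst; near=> t; apply: f0.
  by rewrite in_itv/=; apply/andP; split; near: t;
    [exact: nbhs_left_gt|exact: nbhs_left_lt].
by right; near: t; apply: nbhs_left_gt; lra.
Unshelve. all: by end_near. Qed.

Lemma vanishing_jets (R : realType) (R0 T : R) (v : R * R -> R) :
  smooth_on_Qbar R0 T v -> vanishes_near_ends R0 T v ->
  exists2 d : R, 0 < d & forall x t, x \in `]0, R0[ -> t \in `]0, T[ ->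
    t < 0 + d \/ T - d < t ->
    [/\ v (x, t) = 0, dx R0 v (x, t) = 0 & dt T v (x, t) = 0].
Proof.
move=> sv [d d0 v0]; exists d => // x t xR tT; rewrite add0r => td.
have v00 r u : r \in `]0, R0[ -> u \in `]0, T[ -> u < d \/ T - d < u ->
    v (r, u) = 0.
  by move=> rR uT; apply: v0; split; exact: subset_itv_oo_cc.
have [d1 d2] := smooth_is_derive sv xR tT.
split; first exact: v00.
  by apply: is_derive_near0 d1 => [|r rR]; [exact: xR|exact: v00].
move: (tT); rewrite in_itv/= => /andP[t0 tT'].
case: td => td.
  apply: (@is_derive_near0 _ 0 (Num.min d T) t) d2.
    by rewrite in_itv/= t0 lt_min td.
  move=> u; rewrite in_itv/= lt_min => /and3P[u0 ud uT].
  by apply: v00 => //; [rewrite in_itv/= u0|left].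
apply: (@is_derive_near0 _ (Num.max 0 (T - d)) T t) d2.
  by rewrite in_itv/= tT' andbT gt_max t0.
move=> u; rewrite in_itv/= gt_max => /andP[/andP[u0 ud] uT].
by apply: v00 => //; [rewrite in_itv/= u0|right].
Qed.

(** * The flux of a smooth function *)

Section ConjugatedJets.
Context (R : realType) (c lambda R0 T s : R) (v : R * R -> R).
Hypothesis c0 : 0 < c.
Hypothesis sv : smooth_on_Qbar R0 T v.
Implicit Types z : R * R.

Let m := - lambda.
Let w := weight c lambda s.
Let A := invA c.
Let B := invB c.
Let p := phi c lambda.
Let vx := dx R0 v.
(* The powers of c^-1 pass from t to tau = c t. *)
Let vy z := c^-1 * dt T v z.
Let vxx := dx R0 (dx R0 v).
Let vxy z := c^-1 * dt T (dx R0 v) z.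
Let vyy z := c ^- 2 * dt T (dt T v) z.

Definition conj_v z := w z * v z.
Definition conj_vx z := conjX s m (B z) (p z) (w z) (v z) (vx z).
Definition conj_vt z := conjY s m (A z) (B z) (p z) (w z) (v z) (vy z).
Definition conj_vxx z := conjXX s m (B z) (p z) (w z) (v z) (vx z) (vxx z).
Definition conj_vxt z :=
  conjXY s m (A z) (B z) (p z) (w z) (v z) (vx z) (vy z) (vxy z).
Definition conj_vtt z :=
  conjYY s m (A z) (B z) (p z) (w z) (v z) (vy z) (vyy z).

Definition fluxX_field z :=
  fluxX s m (A z) (B z) (p z) (conj_v z) (conj_vx z) (conj_vt z).
Definition fluxY_field z :=
  fluxY s m (A z) (B z) (p z) (conj_v z) (conj_vx z) (conj_vt z).
Definition divX_field z :=
  divX s m (A z) (B z) (p z) (conj_v z) (conj_vx z) (conj_vt z)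
    (conj_vxx z) (conj_vxt z).
Definition divY_field z :=
  divY s m (A z) (B z) (p z) (conj_v z) (conj_vx z) (conj_vt z)
    (conj_vxt z) (conj_vtt z).

Lemma within_flux_fields :
  [/\ {within Qbar R0 T, continuous fluxX_field},
      {within Qbar R0 T, continuous fluxY_field},
      {within Qbar R0 T, continuous divX_field} &
      {within Qbar R0 T, continuous divY_field}].
Proof.
have [cA cB cp cw] := within_weight_factors R0 T c0 lambda s.
rewrite -/A -/B -/p -/w in cA cB cp cw.
have cv := smooth_within sv.
have cvx : {within Qbar R0 T, continuous vx}.
  exact: smooth_within (smooth_dx sv).
have cvt := smooth_within (smooth_dt sv).
have cvxx : {within Qbar R0 T, continuous vxx}.
  exact: smooth_within (smooth_dx (smooth_dx sv)).
have cvtt := smooth_within (smooth_dt (smooth_dt sv)).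
have cvxt := smooth_within (smooth_dt (smooth_dx sv)).
have cvy : {within Qbar R0 T, continuous vy}.
  exact: withinZ cvt.
have cvxy : {within Qbar R0 T, continuous vxy}.
  exact: withinZ cvxt.
have cvyy : {within Qbar R0 T, continuous vyy}.
  exact: withinZ cvtt.
have cW : {within Qbar R0 T, continuous conj_v} by exact: withinM cw cv.
have [cX cY cXX cXY cYY] :=
  within_conj s m cA cB cp cw cv cvx cvy cvxx cvxy cvyy.
exact: within_flux cA cB cp cW cX cY cXX cXY cYY.
Qed.

Lemma flux_field_is_derive x t : x \in `]0, R0[ -> t \in `]0, T[ ->
  is_derive x 1 (fun r => fluxX_field (r, t)) (divX_field (x, t)) /\
  is_derive t 1 (fun r => fluxY_field (x, r)) (c * divY_field (x, t)).
Proof.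
move=> xR tT.
have Dz : Qbar R0 T (x, t) by split; exact: subset_itv_oo_cc.
have [/= den1 den2] := Qbar_denominators c0 Dz.
have a0 : 0 < 1 + c * t by lra.
have b0 : 0 < 1 + x + c * t by lra.
have sx := smooth_dx sv; have st := smooth_dt sv.
have [v1 v2] := smooth_is_derive sv xR tT.
have [vx1 vx2] := smooth_is_derive sx xR tT.
have [vt1 vt2] := smooth_is_derive st xR tT.
have cn0 : c != 0 by rewrite gt_eqF.
split.
- have [dA dB dp dw] := weight_dx lambda s a0 b0.
  have vy1 : is_derive x 1 (fun r => vy (r, t)) (vxy (x, t)).
    apply: is_derive_eq.
    by rewrite /vxy (mixed_partials_smooth sv)// /GRing.scale /= mulr0 addr0.
  have [dW dX dY] := is_derive_conjx dA dB dp dw v1 vx1 vy1.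
  exact: (@is_derive_fluxX R (fun r => A (r, t)) (fun r => B (r, t))
    (fun r => p (r, t)) (fun r => conj_v (r, t)) (fun r => conj_vx (r, t))
    (fun r => conj_vt (r, t)) x s m (conj_vxx (x, t))
    (conj_vxt (x, t)) dA dB dp dW dX dY).
- have [dA dB dp dw] := weight_dt lambda s a0 b0.
  have v2' : is_derive t 1 (fun r => v (x, r)) (c * vy (x, t)).
    by apply: is_derive_eq; rewrite /vy mulrA mulfV ?mul1r.
  have vx2' : is_derive t 1 (fun r => vx (x, r)) (c * vxy (x, t)).
    by apply: is_derive_eq; rewrite /vxy mulrA mulfV ?mul1r.
  have vy2 : is_derive t 1 (fun r => vy (x, r)) (c * vyy (x, t)).
    apply: is_derive_eq; rewrite /vyy /GRing.scale /=.
    by field.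
  have [dW dX dY] := is_derive_conjy dA dB dp dw v2' vx2' vy2.
  exact: (@is_derive_fluxY R (fun r => A (x, r)) (fun r => B (x, r))
    (fun r => p (x, r)) (fun r => conj_v (x, r)) (fun r => conj_vx (x, r))
    (fun r => conj_vt (x, r)) t c s m (conj_vxt (x, t))
    (conj_vtt (x, t)) dA dB dp dW dX dY).
Qed.

Lemma fluxY_field_ends : 0 < T -> vanishes_near_ends R0 T v ->
  forall x, x \in `]0, R0[ -> fluxY_field (x, 0) = 0 /\ fluxY_field (x, T) = 0.
Proof.
move=> T0 /(vanishing_jets sv)[d d0 v0] x xR.
have [_ cF _ _] := within_flux_fields.
have xR' : x \in `[0, R0] by exact: subset_itv_oo_cc.
apply: (within_slice_ends0 T0 d0 (continuous_slice2 cF xR')) => t tT td.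
have [h1 h2 h3] := v0 x t xR tT td.
rewrite /fluxY_field /fluxY /conj_v /conj_vx /conj_vt /conjX /conjY /vx /vy.
rewrite h1 h2 h3.
by ring.
Qed.

End ConjugatedJets.

(** * The integrated estimate *)

Section Densities.
Context (R : realType) (c lambda R0 T s : R) (v : R * R -> R).
Hypothesis c0 : 0 < c.
Implicit Types z : R * R.
Let w := weight c lambda s.
Let p := phi c lambda.

Lemma weight_sqr z : expR (2 * - s * p z) = w z ^+ 2.
Proof. by rewrite /w /weight expr2 -expRD; congr expR; rewrite -/p; ring. Qed.

Lemma interior_densityE z : interior_density c lambda R0 T (- s) v z =
  w z ^+ 2 * (s ^+ 3 * p z ^+ 3 * v z ^+ 2
              + s * (dt T v z ^+ 2 + dx R0 v z ^+ 2)).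
Proof.
by rewrite /interior_density weight_sqr opprK !real_normK ?num_real.
Qed.

Lemma source_densityE z : source_density c lambda R0 T (- s) v z =
  w z ^+ 2 * box c R0 T v z ^+ 2.
Proof. by rewrite /source_density weight_sqr real_normK ?num_real. Qed.

Lemma boundary_densityE z : boundary_density c lambda R0 T (- s) v z =
  w z ^+ 2 * (s ^+ 3 * p z ^+ 3 * v z ^+ 2
              + s * p z * (dt T v z ^+ 2 + dx R0 v z ^+ 2)).
Proof.
by rewrite /boundary_density weight_sqr opprK !real_normK ?num_real.
Qed.

Lemma phi_ge1 z : lambda < 0 -> Qbar R0 T z -> 1 <= phi c lambda z.
Proof.
move=> l0 /(Qbar_denominators c0)[h1 h2].
rewrite /phi -expR0 ler_expR /psi.
by have := ln_ge0 h1; have := ln_ge0 (le_trans h1 h2); nra.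
Qed.

Lemma inverses_bounds z : Qbar R0 T z ->
  [/\ (1 + c * T)^-1 <= invA c z, 0 < invB c z, invB c z <= invA c z &
      invA c z <= 1].
Proof.
move=> Dz; have [h1 h2] := Qbar_denominators c0 Dz.
have [_ /=] := Dz; rewrite in_itv/= => /andP[_ tT].
have a0 : 0 < 1 + c * z.2 by lra.
have b0 : 0 < 1 + z.1 + c * z.2 by lra.
have aT : 1 + c * z.2 <= 1 + c * T by rewrite lerD2l ler_pM2l.
rewrite /invA /invB; split.
- by rewrite lef_pV2 ?posrE//; lra.
- by rewrite invr_gt0.
- by rewrite lef_pV2 ?posrE.
- by rewrite invf_le1.
Qed.

Hypotheses (l3 : - (1 / 3) < lambda) (l0 : lambda < 0).

Lemma interior_density_le z : 0 < T -> 1 <= s * - lambda -> Qbar R0 T z ->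
  (- lambda) ^+ 3 * (1 + c * T)^-1 ^+ 4 / (20 * (1 + c ^+ 2)) *
    interior_density c lambda R0 T (- s) v z <=
  c ^- 4 * source_density c lambda R0 T (- s) v z
  - divX_field c lambda R0 T s v z - divY_field c lambda R0 T s v z.
Proof.
move=> T0 sm Dz.
have [aA B0 BA A1] := inverses_bounds Dz.
have p1 := phi_ge1 l0 Dz.
have cn0 : c != 0 by rewrite gt_eqF.
have a0 : 0 < (1 + c * T)^-1.
  by rewrite invr_gt0 addr_gt0 ?mulr_gt0.
have m0 : 0 < - lambda by rewrite oppr_gt0.
have m3 : - lambda < 1 / 3 by rewrite ltrNl.
have := @pointwise_carleman R s (- lambda) (invA c z) (invB c z)
  (phi c lambda z) (w z) (v z) (dx R0 v z) (c^-1 * dt T v z)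
  (dx R0 (dx R0 v) z) (c ^- 2 * dt T (dt T v) z)
  (c^-1 * dt T (dx R0 v) z) c _ m0 m3 a0 aA B0 BA A1 p1 sm.
rewrite interior_densityE source_densityE (mulVKf cn0).
have -> : w z ^+ 2 * (c ^- 2 * dt T (dt T v) z - dx R0 (dx R0 v) z) ^+ 2 =
    c ^- 4 * (w z ^+ 2 * box c R0 T v z ^+ 2).
  by rewrite /box; field.
by [].
Qed.

Lemma fluxX_boundary_le z : 0 < s -> Qbar R0 T z ->
  `|fluxX_field c lambda R0 T s v z| <=
  (11 + 2 * c ^- 2) * boundary_density c lambda R0 T (- s) v z.
Proof.
move=> s0 Dz.
have [aA B0 BA A1] := inverses_bounds Dz.
have p1 := phi_ge1 l0 Dz.
have cn0 : c != 0 by rewrite gt_eqF.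
have m0 : 0 < - lambda by rewrite oppr_gt0.
have m3 : - lambda < 1 / 3 by rewrite ltrNl.
have := @fluxX_le R s (- lambda) (invA c z) (invB c z)
  (phi c lambda z) (w z) (v z) (dx R0 v z) (c^-1 * dt T v z) c
  s0 m0 m3 B0 BA A1 p1 cn0.
by rewrite boundary_densityE (mulVKf cn0).
Qed.

Hypothesis sv : smooth_on_Qbar R0 T v.

Lemma within_densities :
  [/\ {within Qbar R0 T, continuous (interior_density c lambda R0 T (- s) v)},
      {within Qbar R0 T, continuous (source_density c lambda R0 T (- s) v)} &
      {within Qbar R0 T, continuous (boundary_density c lambda R0 T (- s) v)}].
Proof.
have [_ _ cp cw] := within_weight_factors R0 T c0 lambda s.
have cv := smooth_within sv.
have cx := smooth_within (smooth_dx sv).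
have ct := smooth_within (smooth_dt sv).
have cxx := smooth_within (smooth_dx (smooth_dx sv)).
have ctt := smooth_within (smooth_dt (smooth_dt sv)).
rewrite (funext interior_densityE) (funext source_densityE).
rewrite (funext boundary_densityE); split.
- exact: within_density cw cp cv (@within_cst R _ _ s) ct cx.
- have cb : {within Qbar R0 T, continuous (box c R0 T v)}.
    rewrite (_ : box c R0 T v = fun z =>
      dt T (dt T v) z + - (c ^+ 2 * dx R0 (dx R0 v) z)) //.
    apply: withinD; first exact: ctt.
    by apply: withinN; exact: (withinZ (k := c ^+ 2) cxx).
  exact: withinM (withinX (n := 2) cw) (withinX (n := 2) cb).
- have csp : {within Qbar R0 T, continuous (fun z => s * p z)}.
    exact: withinZ.
  exact: (within_density (s := s) cw cp cv csp ct cx).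
Qed.

End Densities.

Lemma integrable_open_itv (R : realType) (a b : R) (f : R -> R) :
  {within `[a, b], continuous f} ->
  (@lebesgue_measure R).-integrable `]a, b[ (EFin \o f).
Proof.
move=> cf.
have h := continuous_compact_integrable (@segment_compact R a b) cf.
apply: (@integrableS _ _ _ _ _ _ _ _ _ _ h).
- exact: measurable_itv.
- exact: measurable_itv.
- exact: subset_itv_oo_cc.
Qed.

Local Notation lebesgue2 R :=
  (@lebesgue_measure R \x @lebesgue_measure R)%E.

(** Integration of [interior_density_le]: the tau-divergence disappears, the
    x-divergence becomes the difference of the flux at x = R0 and x = 0. *)
Lemma carleman_estimate (R : realType) (c lambda R0 T s : R) (v : R * R -> R) :
  0 < c -> 0 < T -> - (1 / 3) < lambda -> lambda < 0 -> 0 < R0 ->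
  smooth_on_Qbar R0 T v -> vanishes_near_ends R0 T v ->
  0 < s -> 1 <= s * - lambda ->
  (- lambda) ^+ 3 * (1 + c * T)^-1 ^+ 4 / (20 * (1 + c ^+ 2)) *
    \int[lebesgue2 R]_(z in Q R0 T)
      interior_density c lambda R0 T (- s) v z
  <= c ^- 4 *
    \int[lebesgue2 R]_(z in Q R0 T)
      source_density c lambda R0 T (- s) v z
  + (11 + 2 * c ^- 2) *
    (\int[@lebesgue_measure R]_(t in `]0, T[)
       boundary_density c lambda R0 T (- s) v (0, t)
     + \int[@lebesgue_measure R]_(t in `]0, T[)
         boundary_density c lambda R0 T (- s) v (R0, t)).
Proof.
move=> c0 T0 l3 l0 R00 sv vv s0 sm.
set S := boundary_density c lambda R0 T (- s) v.
set kap := _ / (20 * _); set k4 := c ^- 4; set kb := 11 + _.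
have [cFX cFY cdX cdY] := within_flux_fields lambda s c0 sv.
have [cI cS cB] := within_densities lambda s c0 sv.
have mQ := measurable_Q R0 T.
have iI := integrable_Q cI; have iS := integrable_Q cS.
have idX := integrable_Q cdX; have idY := integrable_Q cdY.
set FX := fluxX_field c lambda R0 T s v in cFX *.
set FY := fluxY_field c lambda R0 T s v in cFY *.
set dX := divX_field c lambda R0 T s v in cdX idX *.
set dY := divY_field c lambda R0 T s v in cdY idY *.
have H1 : kap * Rintegral (lebesgue2 R) (Q R0 T)
      (interior_density c lambda R0 T (- s) v) <=
    k4 * Rintegral (lebesgue2 R) (Q R0 T)
      (source_density c lambda R0 T (- s) v)
    - Rintegral (lebesgue2 R) (Q R0 T) dX
    - Rintegral (lebesgue2 R) (Q R0 T) dY.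
  rewrite -RintegralZl// -RintegralZl//.
  have ikS := integrable_Q (withinZ (k := k4) cS).
  have cD : {within Qbar R0 T, continuous (fun z =>
      k4 * source_density c lambda R0 T (- s) v z + - dX z)}.
    by apply: withinD; [exact: withinZ|exact: withinN].
  rewrite -RintegralB// -RintegralB//; last exact: integrable_Q cD.
  apply: le_Rintegral => //.
  - exact: integrable_Q (withinZ (k := kap) cI).
  - by apply: integrable_Q; apply: withinD cD _; exact: withinN.
  - move=> z /(@subset_Q_Qbar R R0 T) Dz.
    exact: interior_density_le.
have H2 : Rintegral (lebesgue2 R) (Q R0 T) dY = 0.
  have I0 : (\int[(@lebesgue_measure R \x @lebesgue_measure R)]_(z in Q R0 T)
      (c * dY z)%:E = 0)%E.
    apply: (integral_dt T0 cFY); first exact: withinZ.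
      by move=> x t xR tT; have [] := flux_field_is_derive lambda s c0 sv xR tT.
    by move=> x xR; apply: fluxY_field_ends.
  have /eqP : c * Rintegral (lebesgue2 R) (Q R0 T) dY = 0.
    by rewrite -RintegralZl// /Rintegral I0.
  by rewrite mulf_eq0 (gt_eqF c0) => /eqP.
have H3 : Rintegral (lebesgue2 R) (Q R0 T) dX =
    Rintegral (@lebesgue_measure R) `]0%R, T[ (fun t => FX (R0, t) - FX (0, t)).
  congr fine; apply: (integral_dx R00 cFX cdX) => x t xR tT.
  by have [] := flux_field_is_derive lambda s c0 sv xR tT.
have R0i : R0 \in `[0, R0] by rewrite in_itv/= lexx ltW.
have i0 : (0 : R) \in `[0, R0] by rewrite in_itv/= lexx ltW.
have cF x : x \in `[0, R0] -> {within `[0, T], continuous (fun t => FX (x, t))}.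
  exact: continuous_slice2.
have cSl x : x \in `[0, R0] -> {within `[0, T], continuous (fun t => S (x, t))}.
  exact: continuous_slice2.
have H4 : - Rintegral (@lebesgue_measure R) `]0%R, T[
      (fun t => FX (R0, t) - FX (0, t)) <=
    kb * (Rintegral (@lebesgue_measure R) `]0%R, T[ (fun t => S (0, t))
     + Rintegral (@lebesgue_measure R) `]0%R, T[ (fun t => S (R0, t))).
  have mT : measurable (`]0%R, T[ : set (measurableTypeR R)).
    exact: measurable_itv.
  rewrite -RintegralD; first last.
  - exact/integrable_open_itv/cSl.
  - exact/integrable_open_itv/cSl.
  - exact: mT.
  have cSS : {within `[0, T], continuous (fun t => S (0, t) + S (R0, t))}.
    by apply: withinD; exact: cSl.
  rewrite -RintegralZl//; last exact: integrable_open_itv.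
  rewrite -mulN1r -RintegralZl//; last first.
    apply: integrable_open_itv.
    by apply: withinD; [exact: cF|apply: withinN; exact: cF].
  apply: le_Rintegral => //.
  - apply: integrable_open_itv; apply: withinZ.
    by apply: withinD; [exact: cF|apply: withinN; exact: cF].
  - by apply: integrable_open_itv; exact: withinZ.
  - move=> t tT.
    have tT' : t \in `[0, T] by exact: subset_itv_oo_cc.
    have B0 : `|FX (0, t)| <= kb * S (0, t) by exact: fluxX_boundary_le.
    have BR : `|FX (R0, t)| <= kb * S (R0, t) by exact: fluxX_boundary_le.
    rewrite mulN1r opprB mulrDr; apply: lerD.
      exact: le_trans (ler_norm _) B0.
    by rewrite (le_trans _ BR)// -normrN ler_norm.
apply: (le_trans H1); rewrite H2 subr0 lerD2l H3.
exact: H4.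
Qed.

Lemma integral_EFin_Rintegral d (U : measurableType d) (R : realType)
    (nu : {measure set U -> \bar R}) (D : set U) (f : U -> R) :
  measurable D -> nu.-integrable D (EFin \o f) ->
  (\int[nu]_(z in D) (f z)%:E = (\int[nu]_(z in D) f z)%R%:E)%E.
Proof. by move=> mD fi; rewrite /Rintegral fineK// integrable_fin_num. Qed.

Unset Implicit Arguments.

Theorem theorem3p1 (R : realType) (c T lambda beta : R)
    (hc : 0 < c) (hT : 0 < T)
    (hlambda : - (1 / 3) < lambda) (hlambda0 : lambda < 0)
    (hbeta0 : 0 < beta)
    (hbeta : beta < 1 - (4 * lambda + 2) /
                        Num.sqrt ((2 * lambda + 3) * (8 * lambda + 3))) :
  exists C S0 : R, [/\ 0 < C, 1 <= S0 &
    forall R0 : R, 0 < R0 ->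
    forall v : R * R -> R,
      smooth_on_Qbar R0 T v -> vanishes_near_ends R0 T v ->
    forall s : R, s <= - S0 ->
    (\int[(@lebesgue_measure R \x @lebesgue_measure R)]_(z in Q R0 T)
        (interior_density c lambda R0 T s v z)%:E
     <=
     C%:E * (\int[(@lebesgue_measure R \x @lebesgue_measure R)]_(z in Q R0 T)
        (source_density c lambda R0 T s v z)%:E)
     + C%:E * (\int[@lebesgue_measure R]_(t in `]0%R, T[)
        (boundary_density c lambda R0 T s v (0%R, t))%:E)
     + C%:E * (\int[@lebesgue_measure R]_(t in `]0%R, T[)
        (boundary_density c lambda R0 T s v (R0, t))%:E))%E].
Proof.
pose m := - lambda.
have m0 : 0 < m by rewrite oppr_gt0.
have aT : 0 < (1 + c * T)^-1 by rewrite invr_gt0 addr_gt0 ?mulr_gt0.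
pose kap := (- lambda) ^+ 3 * (1 + c * T)^-1 ^+ 4 / (20 * (1 + c ^+ 2)).
have kap0 : 0 < kap.
  rewrite /kap divr_gt0 ?mulr_gt0 ?exprn_gt0//.
  by rewrite ltr_pwDl// sqr_ge0.
pose k4 := c ^- 4; pose kb := 11 + 2 * c ^- 2.
have k40 : 0 < k4 by rewrite invr_gt0 exprn_gt0.
have kb0 : 0 < kb by rewrite addr_gt0// mulr_gt0// invr_gt0 exprn_gt0.
(* The threshold is the condition sigma mu >= 1 under which the remainder is
   absorbed. *)
exists ((k4 + kb) / kap), (Num.max 1 m^-1); split.
- by rewrite divr_gt0// addr_gt0.
- by rewrite le_max lexx.
move=> R0 R00 v sv vv s' hs'.
pose s := - s'.
have -> : s' = - s by rewrite opprK.
have hs : Num.max 1 m^-1 <= s by rewrite /s lerNr.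
have s1 : 1 <= s by apply: le_trans hs; rewrite le_max lexx.
have s0 : 0 < s by exact: lt_le_trans s1.
have sm : 1 <= s * m.
  rewrite -ler_pdivrMr// mul1r; apply: le_trans hs.
  by rewrite le_max lexx orbT.
have H := @carleman_estimate R c lambda R0 T s v hc hT hlambda hlambda0 R00
  sv vv s0 sm.
have [cI cS cB] := within_densities lambda s hc sv.
have ib x : x \in `[0, R0] -> (@lebesgue_measure R).-integrable `]0, T[
    (EFin \o (fun t => boundary_density c lambda R0 T (- s) v (x, t))).
  by move=> xR; apply: integrable_open_itv; exact: continuous_slice2 cB xR.
have i0 : (0 : R) \in `[0, R0] by rewrite in_itv/= lexx ltW.
have iR : R0 \in `[0, R0] by rewrite in_itv/= lexx ltW.
have mT : measurable (`]0%R, T[ : set (measurableTypeR R)).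
  exact: measurable_itv.
rewrite (integral_EFin_Rintegral (measurable_Q R0 T) (integrable_Q cI)).
rewrite (integral_EFin_Rintegral (measurable_Q R0 T) (integrable_Q cS)).
rewrite (integral_EFin_Rintegral mT (ib _ i0)).
rewrite (integral_EFin_Rintegral mT (ib _ iR)).
move: H; rewrite -/kap -/k4 -/kb.
set I := Rintegral _ _ _; set S := Rintegral _ _ _.
set B0 := Rintegral _ _ _; set BR := Rintegral _ _ _ => H.
have S_ge0 : 0 <= S.
  by apply: Rintegral_ge0 => z _; rewrite source_densityE mulr_ge0 ?sqr_ge0.
have b_ge0 x t : x \in `[0, R0] -> t \in `]0, T[ ->
    0 <= boundary_density c lambda R0 T (- s) v (x, t).
  move=> xR tT.
  have Dz : Qbar R0 T (x, t) by split => //; exact: subset_itv_oo_cc.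
  have := fluxX_boundary_le v hc hlambda hlambda0 s0 Dz.
  by move=> /(le_trans (normr_ge0 _)); rewrite pmulr_rge0.
have B0_ge0 : 0 <= B0 by apply: Rintegral_ge0 => t tT; exact: b_ge0.
have BR_ge0 : 0 <= BR by apply: Rintegral_ge0 => t tT; exact: b_ge0.
have T1 : k4 * S + kb * (B0 + BR) <= (k4 + kb) * S + (k4 + kb) * B0
    + (k4 + kb) * BR.
  have := mulr_ge0 (ltW kb0) S_ge0; have := mulr_ge0 (ltW k40) B0_ge0.
  have := mulr_ge0 (ltW k40) BR_ge0.
  by clearbody S B0 BR k4 kb; lra.
clearbody I S B0 BR k4 kb kap.
rewrite -!EFinM -!EFinD lee_fin -(ler_pM2l kap0).
apply: (le_trans H); apply: (le_trans T1).
rewrite !mulrDr ![kap * (_ / kap * _)]mulrA ![kap * (_ / kap)]mulrC.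
by rewrite !divfK// gt_eqF.
Qed.
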